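(* Assume that for any $\pi\in(0,1)$ and any integers $n\ge m\ge 0$, the law of $\Pi_{m+1}$ under $\mathbb{P}_{m,\pi}$ (i.e. conditional on $\Pi_m=\pi$) dominates the law of $\Pi_{n+1}$ under $\mathbb{P}_{n,\pi}$ (i.e. conditional on $\Pi_n=\pi$) in convex order. Then $V(n,\pi)$ is non-decreasing in $n$ for each $\pi$, and the boundaries $b_1$ and $b_2$ are thus non-decreasing and non-increasing, respectively, as functions of $n$.
   Context: $\mathbb{N}_0=\{0,1,2,\dots\}$ and $a\wedge b=\min\{a,b\}$. Let $\nu$ be a nonzero $\sigma$-finite measure on $\mathbb{R}$. Define $B(u)=\log\int_{\mathbb{R}}e^{ux}\,\nu(dx)$, $N=\{u\in\mathbb{R}:\int_{\mathbb{R}}e^{ux}\,\nu(dx)<\infty\}$ (an interval), $N^\circ$ the interior of $N$, and for $u\in N$ let $p_u(x)=\exp\{ux-B(u)\}$. Let $\mu$ (the prior distribution) be a probability measure concentrated on $N^\circ$, with support $S$. Fix $\theta_0\in\mathbb{R}$ and set $S^+=S\cap(\theta_0,\infty)$, $S^-=S\cap(-\infty,\theta_0]$. Assume $0<\mu(S^+)<1$, and that $\int_S e^{uy-nB(u)}\,\mu(du)<\infty$ for all $n\in\mathbb{N}_0$ and $y\in\mathbb{R}$. For $n\in\mathbb{N}_0$, $y\in\mathbb{R}$ put $$q(n,y)=\frac{\int_{S^+}e^{uy-nB(u)}\mu(du)}{\int_{S}e^{uy-nB(u)}\mu(du)},\qquad \mu_{n,y}(du)=\frac{e^{uy-nB(u)}\mu(du)}{\int_{S}e^{vy-nB(v)}\mu(dv)}.$$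 For each $n$, $y\mapsto q(n,y)$ is an increasing bijection $\mathbb{R}\to(0,1)$; for $\pi\in(0,1)$, $y(n,\pi)$ denotes the unique value with $q(n,y(n,\pi))=\pi$. For $n\in\mathbb{N}_0$ and $\pi\in(0,1)$, $\mathbb{P}_{n,\pi}$ (with expectation $\mathbb{E}_{n,\pi}$) is the probability measure under which a random variable $\Theta$ has distribution $\mu_{n,y(n,\pi)}$ and, conditional on $\Theta=u$, the observations $X_{n+1},X_{n+2},\dots$ are independent with law $p_u(x)\,\nu(dx)$. Under $\mathbb{P}_{n,\pi}$ the posterior probability process is $\Pi_{n+k}=q\bigl(n+k,\,y(n,\pi)+X_{n+1}+\dots+X_{n+k}\bigr)$, $k\ge 0$, so that $\Pi_n=\pi$ and $\Pi_{n+k}=\mathbb{P}_{n,\pi}(\Theta>\theta_0\mid X_{n+1},\dots,X_{n+k})$. Let $c>0$ be a constant. The value function is, for $n\in\mathbb{N}_0$ and $\pi\in(0,1)$, $$V(n,\pi)=\inf_{\tau}\mathbb{E}_{n,\pi}\bigl[\Pi_{n+\tau}\wedge(1-\Pi_{n+\tau})+c\tau\bigr],$$ where the infimum is over $\mathbb{N}_0$-valued stopping times $\tau$ of the filtration $(\sigma(X_{n+1},\dots,X_{n+k}))_{k\ge 0}$. It is extended to $\mathbb{N}_0\times[0,1]$ by $V(n,0)=V(n,1)=0$ for all $n$. The boundaries $b_1:\mathbb{N}_0\to[0,\frac12]$ and $b_2:\mathbb{N}_0\to[\frac12,1]$ are the (existing, uniquely determined) functions such that $$\{(n,\pi)\in\mathbb{N}_0\times[0,1]:V(n,\pi)<\pi\wedge(1-\pi)\}=\{(n,\pi)\in\mathbb{N}_0\times[0,1]:b_1(n)<\pi<b_2(n)\}.$$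 A $[0,1]$-valued random variable $Z$ (or its law) dominates $Z'$ in convex order if $\mathbb{E}[f(Z)]\ge\mathbb{E}[f(Z')]$ for every convex function $f:[0,1]\to\mathbb{R}$. *)

(* Defs.v *)
From HB Require Import structures.
From mathcomp Require Import all_boot all_order all_algebra.
From mathcomp Require Import all_classical all_reals all_analysis.
Set Implicit Arguments.
Unset Strict Implicit.
Unset Printing Implicit Defensive.
Import Order.TTheory GRing.Theory Num.Theory.
Import numFieldNormedType.Exports.
Local Open Scope classical_set_scope.
Local Open Scope ring_scope.

Section exponential_family.
Context {R : realType}.
Variable nu : {measure set R -> \bar R}.

Definition laplace (u : R) : \bar R := (\int[nu]_x (expR (u * x))%:E)%E.

Definition natural_parameters : set R := [set u | (laplace u < +oo)%E].

(* Only meaningful on [natural_parameters]; the value elsewhere is a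
   convention of [fine], and is never seen by a prior concentrated on the
   interior of [natural_parameters]. *)
Definition cumulant (u : R) : R := ln (fine (laplace u)).

Definition density (u x : R) : R := expR (u * x - cumulant u).

Definition obs_law (u : R) (A : set R) : \bar R :=
  (\int[nu]_(x in A) (density u x)%:E)%E.

End exponential_family.

Section posterior.
Context {R : realType}.
Variables (nu mu : {measure set R -> \bar R}) (theta0 : R).

Definition msupport : set R :=
  [set u | forall U : set R, open U -> U u -> (0 < mu U)%E].

Definition Splus : set R := msupport `&` [set u | theta0 < u].

Definition mass (n : nat) (y : R) (A : set R) : \bar R :=
  (\int[mu]_(u in A) (expR (u * y - n%:R * cumulant nu u))%:E)%E.

Definition q (n : nat) (y : R) : R :=
  fine (mass n y Splus) / fine (mass n y msupport).

Definition posterior (n : nat) (y : R) (A : set R) : \bar R :=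
  (fine (mass n y (msupport `&` A)) / fine (mass n y msupport))%:E.

(* For [0 < pi < 1] the equation [q n y = pi] has exactly one solution. *)
Definition yinv (n : nat) (pi : R) : R := xget 0 [set y | q n y = pi].

End posterior.

Section observations.
Context {R : realType} {d : measure_display} {Omega : measurableType d}.
Variables (nu mu : {measure set R -> \bar R}) (theta0 : R).
Variables (Theta : Omega -> R) (X : nat -> Omega -> R).
Variable P : nat -> R -> probability Omega R.

(* [P n pi] is the measure $P_{n,\pi}$.  The second clause says that, for each
   [k], the conditional law of [X n.+1, ..., X (n + k)] given [Theta = u] is
   the product of [k] copies of [obs_law nu u], conditional probabilities being
   characterised by their integrals over the events of sigma(Theta).  The
   variables [X 0, ..., X n] are unconstrained under [P n pi]. *)
Definition sampling_model : Prop :=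
  forall (n : nat) (pi : R), 0 < pi < 1 ->
    (forall A : set R, measurable A ->
       P n pi (Theta @^-1` A) =
       posterior nu mu n (yinv nu mu theta0 n pi) A)
    /\
    (forall (k : nat) (A : set R) (B : nat -> set R),
       measurable A -> (forall i, measurable (B i)) ->
       P n pi (Theta @^-1` A `&`
               \bigcap_(i in `I_k) (X (n + i).+1 @^-1` B i)) =
       (\int[P n pi]_(w in Theta @^-1` A)
          \prod_(i < k) obs_law nu (Theta w) (B i))%E).

(* [Pi n pi k] is $\Pi_{n+k}$ under $P_{n,\pi}$. *)
Definition Pi (n : nat) (pi : R) (k : nat) (w : Omega) : R :=
  q nu mu theta0 (n + k)
    (yinv nu mu theta0 n pi + \sum_(i < k) X (n + i).+1 w).

Definition filtration (n k : nat) : set (set Omega) :=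
  <<s [set E | exists i (B : set R),
         [/\ (i < k)%N, measurable B & E = X (n + i).+1 @^-1` B]] >>.

Definition stopping_time (n : nat) (tau : Omega -> nat) : Prop :=
  forall k, filtration n k [set w | (tau w <= k)%N].

Definition stopping_cost (c : R) (n : nat) (pi : R) (tau : Omega -> nat)
    (w : Omega) : R :=
  Num.min (Pi n pi (tau w) w) (1 - Pi n pi (tau w) w) + c * (tau w)%:R.

(* The cost is nonnegative, so the expectation is always meaningful, although
   it may be [+oo] for some stopping times. *)
Definition V (c : R) (n : nat) (pi : R) : \bar R :=
  if 0 < pi < 1 then
    ereal_inf [set ('E_(P n pi)[stopping_cost c n pi tau])%E
              | tau in stopping_time n]
  else 0%E.

Definition boundaries (c : R) (b1 b2 : nat -> R) : Prop :=
  [/\ forall n, 0 <= b1 n <= 2^-1,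
      forall n, 2^-1 <= b2 n <= 1 &
      forall n pi, 0 <= pi <= 1 ->
        (V c n pi < (Num.min pi (1 - pi))%:E)%E <-> b1 n < pi < b2 n].

End observations.

(* Convex functions on [0, 1] are represented by functions on [R] that are
   convex on [0, 1] and arbitrary elsewhere; the two random variables are meant
   to be [0, 1]-valued. *)
Definition convex_dominates {R : realType}
    {d1 : measure_display} {T1 : measurableType d1} (P1 : probability T1 R)
    (Z1 : T1 -> R)
    {d2 : measure_display} {T2 : measurableType d2} (P2 : probability T2 R)
    (Z2 : T2 -> R) : Prop :=
  forall f : R -> R, convex_function (`[0, 1]%classic : set R) f ->
    ('E_P2[f \o Z2] <= 'E_P1[f \o Z1])%E.

(* Main.v *)
(* The value [vtrunc N] of the problem with at most [N] further observations is
   given by backward induction, V_0(n, p) = min(p, 1 - p) and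
   V_{N+1}(n, p) = min(p, 1 - p, c + E_{n,p}[V_N(n + 1, Pi_{n+1})]).  It decreases
   to the value function: stopping when stopping is optimal attains it, and for
   any stopping time tau it exceeds the expected cost by at most P(tau >= N).

   Each V_N(n, .) is concave.  Let p0 be the mixture of p1 and p2 with weights l
   and 1 - l, and y_i the state with q(n, y_i) = p_i.  The difference of the
   mixed posterior density at y1, y2 and of the one at y0 has integral 0 on both
   sides of theta0, and its sign is that of a quasi-convex function minus a
   constant, so on each side it changes sign once, being negative near theta0.
   Against a supporting line of f at q(n + 1, y0 + x), the posterior means of its
   values at 1 and at 0 are monotone in the parameter, and Chebyshev's inequality
   on each side shows that E_{n,p}[f(Pi_{n+1})] is concave in p.

   Convex order applied to the convex function -V_N(n + 1, .) then gives, by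
   induction on N, that V_N is nondecreasing in n; let N tend to infinity. *)

Require Import Defs.
From HB Require Import structures.
From mathcomp Require Import all_boot all_order all_algebra.
From mathcomp Require Import all_classical all_reals all_analysis.
From mathcomp Require Import measurable_realfun ring lra.
Set Implicit Arguments.
Unset Strict Implicit.
Unset Printing Implicit Defensive.
Import Order.TTheory GRing.Theory Num.Theory.
Import numFieldNormedType.Exports.
Local Open Scope classical_set_scope.
Local Open Scope ring_scope.

(** * Integration *)

(** The function [V] is never shown to be concave, measurable or a solution of a dynamic programming
    equation. Everything structural is proved for [vtrunc], which is built from [next_mean], an
    integral over [nu] that does not mention the sample space. The link between the two is
    [next_mean_conditional]. The sampling model only prescribes probabilities of cylinders
    intersected with events of [Theta], so the posterior and predictive laws given the past have to
    be recovered from these. The obstacle to concavity is that changing [p] changes both the law of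
    the next observation and the map from that observation to the next posterior probability. A
    supporting line chosen for each [x] from the state [y0], and kept while [y] varies, removes the
    second dependence. Indeed [f q <= q * t1 + (1 - q) * t0], and [q] times the predictive density
    is the part of that density due to parameters above [theta0]; so the bound is an integral
    against the posterior density. The constraint [f p <= min(p, 1 - p)] puts [t1] and [t0] in
    [0, 1], which keeps all integrals finite. *)

Section density_measures.
Context {R : realType} {d : measure_display} {T : measurableType d}.
Local Open Scope ereal_scope.
Import HBNNSimple.

(** Bundling the indefinite integral as a measure lets integral identities be proved by uniqueness
    of measures on a pi-system. *)
Lemma density_measure_exists (mu : {measure set T -> \bar R}) (f : T -> \bar R) :
  measurable_fun setT f -> (forall x, 0 <= f x) ->
  exists m : {measure set T -> \bar R}, forall A, m A = \int[mu]_(x in A) f x.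
Proof.
move=> mf f0; pose m (A : set T) := \int[mu]_(x in A) f x.
have m0 : m set0 = 0 by rewrite /m integral_set0.
have mge A : 0 <= m A by exact: integral_ge0.
have ms : semi_sigma_additive m.
  move=> F mF tF mUF; rewrite /m ge0_integral_bigcup//; last first.
    exact: measurable_funTS.
  by apply: is_cvg_ereal_nneg_natsum_cond => n _ _; exact: integral_ge0.
pose M := isMeasure.Build _ _ _ m m0 mge ms.
by exists (HB.pack_for (measure T R) m M).
Qed.

(** On indicators this is the hypothesis on [m]; linearity gives it for simple functions and
    monotone convergence for [g]. *)
Lemma density_integral (mu m : {measure set T -> \bar R}) (f : T -> R)
    (g : T -> \bar R) :
  measurable_fun setT f -> (forall x, (0 <= f x)%R) ->
  (forall A, measurable A -> m A = \int[mu]_(x in A) (f x)%:E) ->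
  measurable_fun setT g -> (forall x, 0 <= g x) ->
  \int[m]_x g x = \int[mu]_x (g x * (f x)%:E).
Proof.
move=> mf f0 mE mg g0.
have mf' : measurable_fun setT (EFin \o f) by exact/measurable_EFinP.
pose g_ := nnsfun_approx measurableT mg.
have mgn n : measurable_fun setT (EFin \o g_ n).
  exact/measurable_EFinP/measurable_funP.
transitivity (limn (fun n => \int[m]_x (g_ n x)%:E)).
  rewrite -monotone_convergence//.
  - apply: eq_integral => y _; apply/esym/cvg_lim => //.
    exact: cvg_nnsfun_approx.
  - by move=> n y _; rewrite lee_fin.
  - by move=> y _ a b ab; rewrite lee_fin; exact/lefP/nd_nnsfun_approx.
rewrite [X in limn X](_ : _ = (fun n => \int[mu]_x ((g_ n x)%:E * (f x)%:E))).
  rewrite -monotone_convergence//.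
  - apply: eq_integral => y _; apply/cvg_lim => //.
    have h : (g_ n y)%:E @[n --> \oo] --> g y by exact: (cvg_nnsfun_approx measurableT mg (fun t _ => g0 t)).
    exact: (cvgeZr _ h).
  - by move=> n; exact: (emeasurable_funM (mgn n) mf').
  - by move=> n y _; rewrite mule_ge0// lee_fin.
  - move=> y _ a b ab; apply: lee_wpmul2r; rewrite lee_fin//.
    exact/lefP/nd_nnsfun_approx.
apply/funext => n.
have mI r : measurable (g_ n @^-1` [set r]) by [].
under [LHS]eq_integral do rewrite fimfunE -fsumEFin//.
rewrite [LHS]ge0_integral_fsum//; last 2 first.
  - by move=> r; exact/measurable_EFinP/measurable_funM.
  - by move=> r x _; rewrite EFinM nnfun_muleindic_ge0.
under [RHS]eq_integral.
  move=> x _; rewrite fimfunE -fsumEFin// ge0_mule_fsuml; last first.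
    by move=> r; rewrite EFinM nnfun_muleindic_ge0.
  over.
rewrite [RHS]ge0_integral_fsum//; last 2 first.
  - move=> r; apply: emeasurable_funM => //.
    exact/measurable_EFinP/measurable_funM.
  - move=> r x _; apply: mule_ge0; last by rewrite lee_fin.
    by rewrite EFinM nnfun_muleindic_ge0.
apply: eq_fsbigr => r _.
rewrite integralZl_indic_nnsfun// integral_indic// setIT mE//.
have [r0|r0] := ltP r 0%R.
  rewrite preimage_nnfun0// integral_set0 mule0; apply/esym.
  by apply: integral0_eq => x _; rewrite indicE in_set0 mulr0 mul0e.
rewrite integral_mkcond -ge0_integralZl//.
- apply: eq_integral => x _; rewrite /= EFinM -muleA; congr (_ * _).
  by rewrite epatch_indic muleC.
- by apply/(measurable_restrictT _ (mI r)).1; exact: measurable_funTS.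
- by move=> x _; rewrite patchE; case: ifP => // _; rewrite lee_fin.
Qed.

(** Dynkin's uniqueness theorem. As [G] contains the whole space and [m1] is finite, the constant
    sequence [setT] serves as the exhausting sequence. *)
Lemma eq_measure_g_sigma (G : set (set T)) (m1 m2 : {measure set T -> \bar R}) :
  G `<=` measurable -> setI_closed G -> G setT -> m1 setT < +oo ->
  (forall A, G A -> m1 A = m2 A) -> forall A, <<s G >> A -> m1 A = m2 A.
Proof.
move=> Gm GI GT m1fin m12; apply: (g_sigma_algebra_measure_unique G Gm (fun=> setT)) => //.
by rewrite bigcup_const.
Qed.

End density_measures.

Section joint_density.
Context {R : realType} {d1 d2 d3 : measure_display}.
Context {W : measurableType d1} {T1 : measurableType d2} {T2 : measurableType d3}.
Local Open Scope ereal_scope.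

(** The hypothesis says that on [A], given [S], the variable [X] has density [r (S, .)], tested on
    rectangles only. Both sides of the conclusion are integrals of [h] against measures on the
    product: [m1] is the image under [(S, X)] of [P] restricted to [A], and [m2] the image of a
    density against [P] times [nu]. They agree on rectangles, and [m1] is finite. The lemma serves
    twice: for the parameter given the past, and for the next observation given the past. *)
Lemma joint_density_integral (P : probability W R)
    (nu : {sigma_finite_measure set T2 -> \bar R}) (A : set W)
    (S : W -> T1) (X : W -> T2) (r : T1 * T2 -> R) :
  measurable_fun setT S -> measurable_fun setT X -> measurable A ->
  measurable_fun setT r -> (forall z, (0 <= r z)%R) ->
  (forall B C, measurable B -> measurable C ->
    P (A `&` S @^-1` B `&` X @^-1` C) =
    \int[P]_(w in A `&` S @^-1` B) \int[nu]_(x in C) (r (S w, x))%:E) ->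
  forall h : T1 * T2 -> \bar R, measurable_fun setT h -> (forall z, 0 <= h z) ->
  \int[P]_(w in A) h (S w, X w) =
  \int[P]_(w in A) \int[nu]_x (h (S w, x) * (r (S w, x))%:E).
Proof.
move=> mS mX mA mr r0 rect h mh h0.
have mSX : measurable_fun setT (fun w => (S w, X w)).
  exact: measurable_fun_pair.
have mSi : measurable_fun setT (fun z : W * T2 => (S z.1, z.2)).
  apply: measurable_fun_pair; last exact: measurable_snd.
  exact: (measurableT_comp mS measurable_fst).
pose D := A `*` [set: T2].
have mD : measurable D by exact: measurableX.
pose f (z : W * T2) := (\1_D z * r (S z.1, z.2))%R.
have mrS : measurable_fun setT (fun z : W * T2 => r (S z.1, z.2)).
  exact: (measurableT_comp mr mSi).
have mf : measurable_fun setT f by apply: measurable_funM.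
have f0 z : (0 <= f z)%R by rewrite mulr_ge0.
have [m mE] := density_measure_exists (product_measure1 P nu)
  ((measurable_EFinP _ _).2 mf) f0.
have mA1 : measurable_fun setT (EFin \o \1_A : W -> \bar R).
  by apply/measurable_EFinP; exact: measurable_indic.
have [mP mPE] := density_measure_exists P mA1 (fun w => ler0n _ _).
pose SX w := (S w, X w).
pose Si (z : W * T2) := (S z.1, z.2).
pose m1' : {measure set _ -> \bar R} := pushforward mP SX.
pose m2' : {measure set _ -> \bar R} := pushforward m Si.
pose m1 := m1' mSX; pose m2 := m2' mSi.
have DE z (g : \bar R) : g * (f z)%:E = (g * (r (S z.1, z.2))%:E) * (\1_A z.1)%:E.
  rewrite /f EFinM muleCA muleC; congr (_ * _).
  by rewrite /D !indicE in_setX in_setT andbT.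
have fubE g : measurable_fun setT g -> (forall z, 0 <= g z) ->
    \int[product_measure1 P nu]_z (g (S z.1, z.2) * (f z)%:E) =
    \int[P]_(w in A) \int[nu]_x (g (S w, x) * (r (S w, x))%:E).
  move=> mg g0.
  have mgS : measurable_fun setT (fun z : W * T2 => g (S z.1, z.2)).
    exact: (measurableT_comp mg mSi).
  rewrite fubini_tonelli1/=; last 2 first.
  - by apply: emeasurable_funM => //; exact/measurable_EFinP.
  - by move=> z; rewrite mule_ge0// lee_fin.
  rewrite [RHS]integral_mkcond epatch_indic.
  apply: eq_integral => w _; rewrite /fubini_F/=.
  under eq_integral do rewrite DE/=.
  rewrite ge0_integralZr//.
  - exact: (measurableT_comp (emeasurable_funM mg ((measurable_EFinP _ _).2 mr))
      (pair1_measurable (S w))).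
  - by move=> x _; rewrite mule_ge0// lee_fin.
have m1E C : measurable C -> m1 C = P (A `&` SX @^-1` C).
  move=> mC; rewrite /m1/= /pushforward mPE integral_indic//.
  by rewrite -[X in measurable X]setTI; exact: (mSX measurableT C mC).
have m2E C : measurable C -> m2 C =
    \int[P]_(w in A) \int[nu]_x ((\1_C (S w, x))%:E * (r (S w, x))%:E).
  move=> mC; rewrite -(fubE (EFin \o \1_C)); last 2 first.
  - by apply/measurable_EFinP; exact: measurable_indic.
  - by move=> z; rewrite lee_fin.
  rewrite /m2/= /pushforward mE integral_mkcond epatch_indic.
  by apply: eq_integral => z _ /=; rewrite muleC.
have m12 E : measurable E -> m1 E = m2 E.
  rewrite measurable_prod_measurableType.
  apply: eq_measure_g_sigma.
  - by move=> _ [B mB [C mC <-]]; exact: measurableX.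
  - move=> _ _ [B mB [C mC <-]] [B' mB' [C' mC' <-]].
    exists (B `&` B'); first exact: measurableI.
    by exists (C `&` C'); [exact: measurableI|rewrite setXI].
  - by exists setT => //; exists setT => //; rewrite setXTT.
  - rewrite m1E//; apply: (le_lt_trans (probability_le1 _ _)) => //.
      by rewrite preimage_setT setIT.
    exact: ltry.
  - move=> _ [B mB [C mC <-]]; rewrite m1E ?m2E; try exact: measurableX.
    have -> : A `&` SX @^-1` (B `*` C) = A `&` S @^-1` B `&` X @^-1` C.
      by rewrite -setIA; congr (_ `&` _).
    rewrite rect// integral_mkcondr; apply: eq_integral => w wA.
    rewrite patchE; case: ifPn => wB.
      rewrite [LHS]integral_mkcond epatch_indic; apply: eq_integral => x _ /=.
      rewrite muleC !indicE in_setX/=.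
      by rewrite (_ : S w \in B); last by move: wB; rewrite !inE.
    rewrite integral0_eq// => x _; rewrite indicE memNset ?mul0e//.
    by move=> [/= SB _]; move/negP: wB; apply; rewrite inE.
transitivity (\int[m1]_z h z).
  rewrite ge0_integral_pushforward//.
  rewrite preimage_setT (@density_integral _ _ _ P mP (\1_A))//.
  - by rewrite [LHS]integral_mkcond epatch_indic.
  - exact: (measurableT_comp mh mSX).
  - by move=> w; exact: h0.
transitivity (\int[m2]_z h z).
  by apply: eq_measure_integral => E mE' _; exact: m12.
rewrite ge0_integral_pushforward// preimage_setT.
rewrite (@density_integral _ _ _ (product_measure1 P nu) m f)//.
- exact: fubE.
- exact: (measurableT_comp mh mSi).
- by move=> z; exact: h0.
Qed.

End joint_density.

(** * Comparison of integrals of two densities that cross once *)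

Section chebyshev.
Context {R : realType} {d : measure_display} {T : measurableType d}.

(* With [K] the supremum of [phi] over [b < a], the sign condition makes
   [(a - b) * (phi - K)] nonpositive. *)
Lemma integral_le_of_crossing (mu : {measure set T -> \bar R}) (A : set T)
    (a b phi : T -> R) :
  measurable A -> measurable_fun A a -> measurable_fun A b ->
  measurable_fun A phi ->
  (forall x, A x -> 0 <= a x) -> (forall x, A x -> 0 <= b x) ->
  (forall x, A x -> 0 <= phi x <= 1) ->
  (\int[mu]_(x in A) (a x)%:E = \int[mu]_(x in A) (b x)%:E)%E ->
  (\int[mu]_(x in A) (a x)%:E < +oo)%E ->
  (forall x y, A x -> A y -> a x <= b x -> b y < a y -> phi y <= phi x) ->
  (\int[mu]_(x in A) (phi x * a x)%:E <= \int[mu]_(x in A) (phi x * b x)%:E)%E.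
Proof.
move=> mA ma mb mphi a0 b0 phi01 ab afin cross.
(* When [b < a] never holds, [sup] returns 0, and [K <= phi] still holds because [phi] is
   nonnegative. *)
pose K := sup [set phi x | x in A `&` [set x | b x < a x]].
have K0 : 0 <= K.
  rewrite /K; have [->|/set0P[z zE]] :=
    eqVneq [set phi x | x in A `&` [set x | b x < a x]] set0.
    by rewrite sup0.
  apply: (le_trans _ (ub_le_sup _ zE)).
    by case: zE => x [Ax _] <-; have /andP[] := phi01 x Ax.
  by exists 1 => _ [x [Ax _] <-]; have /andP[] := phi01 x Ax.
(* This is the nonpositivity of [(a - b) * (phi - K)] without subtraction, so that every term is
   nonnegative and can be integrated in the extended reals. *)
have pw x : A x -> phi x * a x + K * b x <= phi x * b x + K * a x.
  move=> Ax; have [abx|bax] := leP (a x) (b x).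
    have Kphi : K <= phi x.
      rewrite /K; have [->|/set0P nE] :=
        eqVneq [set phi x | x in A `&` [set x | b x < a x]] set0.
        by rewrite sup0; have /andP[] := phi01 x Ax.
      by apply: sup_le_ub => // _ [y [Ay aby] <-]; exact: cross.
    by nra.
  have phiK : phi x <= K.
    apply: ub_le_sup; last by exists x.
    by exists 1 => _ [y [Ay _] <-]; have /andP[] := phi01 y Ay.
  by nra.
have mM (f g : T -> R) : measurable_fun A f -> measurable_fun A g ->
    measurable_fun A (fun x => (f x * g x)%:E).
  by move=> mf mg; apply/measurable_EFinP; exact: measurable_funM.
have ge0 (f : T -> R) : (forall x, A x -> 0 <= f x) -> (forall x, A x -> (0 <= (f x)%:E)%E).
  by move=> f0 x Ax; rewrite lee_fin f0.
have phi0 x : A x -> 0 <= phi x by move=> /phi01/andP[].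
have key (f g : T -> R) : measurable_fun A f -> measurable_fun A g ->
    (forall x, A x -> 0 <= f x) -> (forall x, A x -> 0 <= g x) ->
    (\int[mu]_(x in A) (phi x * f x)%:E + K%:E * \int[mu]_(x in A) (g x)%:E =
     \int[mu]_(x in A) (phi x * f x + K * g x)%:E)%E.
  move=> mf mg f0 g0.
  rewrite -ge0_integralZl//; last exact/measurable_EFinP.
  rewrite -ge0_integralD//.
  - by move=> x Ax; rewrite lee_fin mulr_ge0 ?phi0 ?f0.
  - exact: mM.
  - by move=> x Ax; rewrite -EFinM lee_fin mulr_ge0 ?g0.
  - exact: (mM (cst K)).
have {}key : (\int[mu]_(x in A) (phi x * a x)%:E + K%:E * \int[mu]_(x in A) (b x)%:E
    <= \int[mu]_(x in A) (phi x * b x)%:E + K%:E * \int[mu]_(x in A) (a x)%:E)%E.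
  rewrite !key//; apply: ge0_le_integral => //.
  - by move=> x Ax; rewrite lee_fin addr_ge0 ?mulr_ge0 ?a0 ?b0 ?phi0.
  - by apply/measurable_EFinP/measurable_funD; exact: measurable_funM.
  - by apply/measurable_EFinP/measurable_funD; exact: measurable_funM.
(* The two [K] terms are equal because [a] and [b] have the same integral; finiteness allows them to
   be cancelled. *)
have Kfin : (K%:E * \int[mu]_(x in A) (b x)%:E)%E \is a fin_num.
  by rewrite fin_numM// -ab ge0_fin_numE//; exact/integral_ge0/ge0.
by move: key; rewrite ab leeD2rE.
Qed.

End chebyshev.

(** * Supporting lines of concave functions on the open unit interval *)

Section concave.
Context {R : realType}.
Implicit Types f : R -> R.

Definition concave01 f := forall l p1 p2 : R, 0 < l < 1 -> 0 < p1 < 1 -> 0 < p2 < 1 ->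
  l * f p1 + (1 - l) * f p2 <= f (l * p1 + (1 - l) * p2).

(* [t1 p] and [t0 p] are the values at 1 and at 0 of a supporting line of [f]
   at [p]. *)
Definition supporting_lines f (t1 t0 : R -> R) :=
  forall p r, 0 < p < 1 -> 0 < r < 1 ->
  f p = p * t1 p + (1 - p) * t0 p /\ f r <= r * t1 p + (1 - r) * t0 p.

(** The slope [s p] is the infimum of the chord slopes to the left of [p], that is, the left
    derivative. By concavity ([chord]) each of these is at least every chord slope to the right, so
    the line through [(p, f p)] with slope [s p] lies above [f] on both sides. *)
Lemma supporting_linesP f : concave01 f -> exists t1 t0, supporting_lines f t1 t0.
Proof.
move=> cf.
pose slopes p := [set (f p - f r) / (p - r) | r in [set r | 0 < r < p]].
pose s p := inf (slopes p).
have chord p r r' : 0 < r < p -> p < r' < 1 ->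
    (f r' - f p) / (r' - p) <= (f p - f r) / (p - r).
  move=> /andP[r0 rp] /andP[pr' r'1].
  have l01 : 0 < (p - r) / (r' - r) < 1.
    by rewrite divr_gt0 ?ltr_pdivrMr ?mul1r; lra.
  have := cf _ r' r l01 ltac:(lra) ltac:(lra).
  rewrite (_ : _ * r' + _ = p); last by field; lra.
  rewrite (_ : _ * f r' + _ = ((p - r) * f r' + (r' - p) * f r) / (r' - r)); last first.
    by field; lra.
  rewrite ler_pdivrMr; last by lra.
  move=> H; rewrite ler_pdivrMr; last by lra.
  by rewrite mulrAC ler_pdivlMr; [lra|lra].
have smax p r : 0 < p < 1 -> 0 < r < 1 -> f r <= f p + s p * (r - p).
  move=> p01 r01.
  have ne : slopes p !=set0.
    by exists ((f p - f (p / 2)) / (p - p / 2)); exists (p / 2) => //=; lra.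
  have lb x : p < x < 1 -> lbound (slopes p) ((f x - f p) / (x - p)).
    by move=> px _ [y /= yp <-]; exact: chord.
  have [rp|pr|->] := ltgtP r p.
  - have : s p <= (f p - f r) / (p - r).
      apply: ge_inf; last by exists r => //=; lra.
      by exists ((f ((1 + p) / 2) - f p) / ((1 + p) / 2 - p)); apply: lb; lra.
    by rewrite ler_pdivlMr ?subr_gt0//; lra.
  - have : (f r - f p) / (r - p) <= s p.
      by apply: lb_le_inf => //; apply: lb; lra.
    by rewrite ler_pdivrMr ?subr_gt0//; lra.
  - by rewrite subrr mulr0 addr0.
exists (fun p => f p + s p * (1 - p)), (fun p => f p - s p * p) => p r p01 r01.
split; first by ring.
by have := smax p r p01 r01; lra.
Qed.

(** Each of the two lines passes above the contact point of the other, so they cross between [p] and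
    [r]. Right of the crossing the line at [r] is the lower one, left of it the line at [p] is. *)
Lemma supporting_lines_mono f t1 t0 p r : supporting_lines f t1 t0 ->
  0 < p < 1 -> 0 < r < 1 -> p <= r -> t1 r <= t1 p /\ t0 p <= t0 r.
Proof.
move=> tl p01 r01; rewrite le_eqVlt => /orP[/eqP->//|pr].
have [Ep _] := tl p p p01 p01; have [Er _] := tl r r r01 r01.
have [_ Hpr] := tl p r p01 r01; have [_ Hrp] := tl r p r01 p01.
rewrite {}Er in Hpr; rewrite {}Ep in Hrp.
set a := t1 p in Hpr Hrp *; set b := t1 r in Hpr Hrp *.
set u := t0 p in Hpr Hrp *; set v := t0 r in Hpr Hrp *.
have h : b - a <= v - u.
  by rewrite -(ler_pM2l (_ : 0 < r - p)) ?subr_gt0//; lra.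
by split; nra.
Qed.

(** The line lies above [f >= 0] on the open interval, hence is nonnegative at both ends. With
    [t0 p] nonnegative, [p * t1 p <= f p <= p] gives [t1 p <= 1]; the bound for [t0 p] is
    symmetric. *)
Lemma supporting_lines01 f t1 t0 p : supporting_lines f t1 t0 ->
  (forall r, 0 < r < 1 -> 0 <= f r <= Num.min r (1 - r)) ->
  0 < p < 1 -> 0 <= t1 p <= 1 /\ 0 <= t0 p <= 1.
Proof.
move=> tl fb p01.
have pos r : 0 < r < 1 -> 0 <= r * t1 p + (1 - r) * t0 p.
  move=> r01; have [_] := tl p r p01 r01; apply: le_trans.
  by have /andP[] := fb r r01.
have nneg (a b : R) : (forall r : R, 0 < r < 1 -> 0 <= r * a + (1 - r) * b) -> 0 <= a.
  move=> H; rewrite leNgt; apply/negP => a0.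
  have [b0|b0] := leP b 0.
    by have := H (1 / 2) ltac:(lra); nra.
  (* At [r = 1 - e] the affine function takes the value [a / 2], which is negative. *)
  pose e := - a / (2 * (b - a)).
  have e0 : 0 < e by rewrite divr_gt0//; lra.
  have e1 : e < 1 by rewrite ltr_pdivrMr; lra.
  have := H (1 - e) ltac:(lra).
  rewrite (_ : _ * a + _ = a / 2); first by lra.
  by rewrite /e; field; lra.
have t1ge : 0 <= t1 p by exact: nneg pos.
have t0ge : 0 <= t0 p.
  apply: (nneg _ (t1 p)) => r r01.
  by have := pos (1 - r) ltac:(lra); rewrite opprB addrC subrKC.
have [Ep _] := tl p p p01 p01.
have := fb p p01; rewrite Ep le_min => /and3P[_ h1 h2].
have /andP[p0 p1] := p01.
rewrite t1ge t0ge/=; split.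
- by rewrite -(ler_pM2l p0); nra.
- by rewrite -(ler_pM2l (_ : 0 < 1 - p)) ?subr_gt0//; nra.
Qed.

End concave.

(** * Null sets and positivity of integrals *)

Section integral_facts.
Context {R : realType} {d : measure_display} {T : measurableType d}.
Local Open Scope ereal_scope.

Lemma integral_setE (mu : {measure set T -> \bar R}) (A : set T) (f : T -> \bar R) :
  \int[mu]_(x in A) f x = \int[mu]_x (f x * (\1_A x)%:E).
Proof. by rewrite integral_mkcond epatch_indic. Qed.

Lemma ge0_integral_null_setC (mu : {measure set T -> \bar R}) (A E : set T)
    (f : T -> \bar R) :
  measurable A -> measurable E -> mu (~` E) = 0 -> measurable_fun A f ->
  (forall x, A x -> 0 <= f x) ->
  \int[mu]_(x in A) f x = \int[mu]_(x in A `&` E) f x.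
Proof.
move=> mA mE E0 mf f0.
rewrite (ge0_negligible_integral (N := ~` E))//; last exact: measurableC.
by rewrite setDE setCK.
Qed.

Lemma integral_pos_gt0 (mu : {measure set T -> \bar R}) (A : set T) (f : T -> R) :
  measurable A -> 0 < mu A -> measurable_fun A f -> (forall x, A x -> (0 < f x)%R) ->
  0 < \int[mu]_(x in A) (f x)%:E.
Proof.
move=> mA A0 mf f0.
rewrite lt0e integral_ge0 ?andbT; last by move=> x Ax; rewrite lee_fin ltW// f0.
apply/eqP => I0; move: A0; rewrite lt0e => /andP[/eqP + _]; apply.
have : \int[mu]_(x in A) `|(f x)%:E| = 0.
  by rewrite -[RHS]I0; apply: eq_integral => x /set_mem Ax; rewrite gee0_abs// lee_fin ltW// f0.
move/(ae_eq_integral_abs _ mA ((measurable_EFinP _ _).2 mf)).1 => [N [mN N0 sub]].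
apply: (subset_measure0 (B := N)) => // x Ax; apply: sub => /= /(_ Ax) [fx0].
by have := f0 x Ax; rewrite fx0 ltxx.
Qed.

Lemma probability_null_setC (mu : probability T R) (E A : set T) :
  measurable E -> mu (~` E) = 0 -> measurable A -> mu A = mu (A `&` E).
Proof.
move=> mE E0 mA; have := @ge0_integral_null_setC mu A E (cst 1) mA mE E0.
rewrite !integral_cst//; last exact: measurableI.
by rewrite !mul1e; apply.
Qed.

End integral_facts.

(** * The exponential family *)

Section support.
Context {R : realType}.

Lemma closed_msupport (mu : {measure set R -> \bar R}) : closed (msupport mu).
Proof.
rewrite -openC openE => u /existsNP[U /not_implyP[oU /not_implyP[Uu mU]]].
rewrite /interior; apply/nbhs_ballP.
have /nbhs_ballP[e e0 He] : nbhs u U by exact: open_nbhs_nbhs.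
exists e => // x /He Ux; apply/existsNP; exists U.
by apply/not_implyP; split => //; apply/not_implyP; split.
Qed.

Lemma measurable_msupport (mu : {measure set R -> \bar R}) : measurable (msupport mu).
Proof. by apply: closed_measurable; exact: closed_msupport. Qed.

(* The complement of the support is covered by the countably many null
   intervals with rational endpoints. *)
Lemma msupport_setC0 (mu : {measure set R -> \bar R}) : mu (~` msupport mu) = 0%E.
Proof.
pose J (p : rat * rat) : set R := `]ratr p.1, ratr p.2[%classic.
pose F k := if unpickle k is Some p then
  if mu (J p) == 0%E then J p else set0 else set0.
have F0 k : mu.-negligible (F k).
  rewrite /F; case: unpickle => [p|]; last exact: negligible_set0.
  case: eqP => [I0|_]; last exact: negligible_set0.
  by exists (J p); split => //; exact: measurable_itv.
have [N [mN N0 FN]] := negligible_bigcup F0.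
apply: (subset_measure0 (B := N)) => //.
  by apply: measurableC; exact: measurable_msupport.
move=> u /existsNP[U /not_implyP[oU /not_implyP[Uu /negP]]].
rewrite lt0e measure_ge0 andbT negbK => /eqP U0.
have /nbhs_ballP[e /= e0 He] : nbhs u U by exact: open_nbhs_nbhs.
have [a ua] := rat_in_itvoo (ltac:(lra) : u - e < u).
have [b ub] := rat_in_itvoo (ltac:(lra) : u < u + e).
move: ua ub; rewrite !in_itv/= => /andP[a1 a2] /andP[b1 b2].
apply: (FN u); exists (pickle (a, b)); first exact: I.
rewrite /F pickleK ifT; first by rewrite /J/= in_itv/= a2 b1.
apply/eqP; apply: (subset_measure0 (B := U)) => //.
- exact: measurable_itv.
- exact: open_measurable.
- move=> x; rewrite /J/= in_itv/= => /andP[xa xb]; apply: He.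
  by rewrite /ball/= ltr_norml; lra.
Qed.

End support.

(** The standing hypotheses on [nu], [mu] and [theta0], bundled so that the sections below share a
    single parameter. *)
Record bayes_model (R : realType) := BayesModel {
  obs_measure : {sigma_finite_measure set R -> \bar R};
  prior : probability R R;
  threshold : R;
  obs_measure_neq0 : obs_measure setT <> 0%E;
  prior_natural : prior (interior (natural_parameters obs_measure)) = 1%E;
  mass_msupport_lty : forall n y,
    (mass obs_measure prior n y (msupport prior) < +oo)%E;
  prior_Splus : (0 < prior (Splus prior threshold) < 1)%E }.

Section exponential_family.
Context {R : realType} {M : bayes_model R}.
Local Notation nu := (obs_measure M).
Local Notation mu := (prior M).
Local Notation theta0 := (threshold M).
Local Notation D := (interior (natural_parameters nu)).
Local Notation hi := ([set u | theta0 < u] : set R).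
Local Notation lo := ([set u | u <= theta0] : set R).
Local Notation qq := (q nu mu theta0).
Local Notation yy := (yinv nu mu theta0).

Definition weight (n : nat) (y u : R) : R := expR (u * y - n%:R * cumulant nu u).

(* Both [D] and the support of the prior have full measure, so that [D] may
   replace the support in the definition of [q]. *)
Definition tilted (n : nat) (y : R) (A : set R) : R := fine (mass nu mu n y (D `&` A)).

Lemma measurable_laplace : measurable_fun setT (laplace nu).
Proof.
apply: (measurable_fun_fubini_tonelli_F (fun z : R * R => (expR (z.1 * z.2))%:E)).
- apply/measurable_EFinP; apply: measurableT_comp; first exact: measurable_expR.
  by apply: measurable_funM; [exact: measurable_fst|exact: measurable_snd].
- by move=> z; rewrite lee_fin expR_ge0.
Qed.

Lemma measurable_cumulant : measurable_fun setT (cumulant nu).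
Proof.
apply: measurableT_comp; first exact: measurable_ln.
by apply: measurableT_comp; [exact: fine_measurable|exact: measurable_laplace].
Qed.

Lemma measurable_weight {d} {T : measurableType d} n (f g : T -> R) :
  measurable_fun setT f -> measurable_fun setT g ->
  measurable_fun setT (fun t => weight n (f t) (g t)).
Proof.
move=> mf mg; apply: measurableT_comp; first exact: measurable_expR.
apply: measurable_funB; first exact: measurable_funM.
apply: measurable_funM => //; apply: measurableT_comp => //.
exact: measurable_cumulant.
Qed.

Lemma measurable_density {d} {T : measurableType d} (f g : T -> R) :
  measurable_fun setT f -> measurable_fun setT g ->
  measurable_fun setT (fun t => density nu (f t) (g t)).
Proof.
move=> mf mg; apply: measurableT_comp; first exact: measurable_expR.
apply: measurable_funB; first exact: measurable_funM.
by apply: measurableT_comp => //; exact: measurable_cumulant.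
Qed.

(** Bayes' rule for the family: multiplying by the likelihood of [x] moves the state [(n, y)] to
    [(n + 1, y + x)]. *)
Lemma weightS n y x u : weight n.+1 (y + x) u = weight n y u * density nu u x.
Proof.
rewrite /weight /density -expRD; congr expR.
by rewrite -natr1; ring.
Qed.

Lemma weight_gt0 n y u : 0 < weight n y u. Proof. exact: expR_gt0. Qed.
Lemma density_gt0 u x : 0 < density nu u x. Proof. exact: expR_gt0. Qed.

Lemma measurable_D : measurable D.
Proof. by apply: open_measurable; exact: open_interior. Qed.

Lemma mu_DC0 : mu (~` D) = 0%E.
Proof.
by rewrite probability_setC ?prior_natural ?subee//; exact: measurable_D.
Qed.

Lemma laplace_gt0 u : (0 < laplace nu u)%E.
Proof.
apply: integral_pos_gt0 => //.
- by rewrite lt0e measure_ge0 andbT; exact/eqP/obs_measure_neq0.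
- apply: measurable_funTS; apply: measurableT_comp; first exact: measurable_expR.
  by apply: measurable_funM.
- by move=> x _; exact: expR_gt0.
Qed.

Lemma integral_density u : D u -> (\int[nu]_x (density nu u x)%:E = 1)%E.
Proof.
move=> /interior_subset; rewrite /natural_parameters/= => Lfin.
have Lf : laplace nu u \is a fin_num by rewrite ge0_fin_numE// ltW// laplace_gt0.
have L0 : 0 < fine (laplace nu u) by rewrite fine_gt0// laplace_gt0.
under eq_integral do rewrite /density expRD mulrC EFinM.
rewrite ge0_integralZl//.
- by rewrite -/(laplace nu u) -(fineK Lf) -EFinM expRN /cumulant lnK// mulVf// gt_eqF.
- apply/measurable_EFinP; apply: measurableT_comp; first exact: measurable_expR.
  exact: measurable_funM.
Qed.

Lemma mass_setI n y A : measurable A ->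
  mass nu mu n y (msupport mu `&` A) = mass nu mu n y (D `&` A).
Proof.
move=> mA; rewrite /mass.
have mw B : measurable_fun B (fun u => (weight n y u)%:E).
  by apply: measurable_funTS; apply/measurable_EFinP; exact: measurable_weight.
have w0 u : (0 <= (weight n y u)%:E)%E by rewrite lee_fin ltW// weight_gt0.
rewrite (ge0_integral_null_setC (E := D))//; last 3 first.
- by apply: measurableI => //; exact: measurable_msupport.
- exact: measurable_D.
- exact: mu_DC0.
rewrite [RHS](ge0_integral_null_setC (E := msupport mu))//; last 3 first.
- by apply: measurableI => //; exact: measurable_D.
- exact: measurable_msupport.
- exact: msupport_setC0.
by rewrite (setIC (msupport mu `&` A)) (setIC (msupport mu)) setIA.
Qed.

Lemma mass_ltoo n y A : measurable A -> (mass nu mu n y (D `&` A) < +oo)%E.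
Proof.
move=> mA; rewrite -mass_setI//; apply: le_lt_trans (mass_msupport_lty M n y).
apply: ge0_subset_integral => //.
- by apply: measurableI => //; exact: measurable_msupport.
- exact: measurable_msupport.
- by apply: measurable_funTS; apply/measurable_EFinP; exact: measurable_weight.
Qed.

Lemma tiltedE n y A : measurable A ->
  ((tilted n y A)%:E = \int[mu]_(u in D `&` A) (weight n y u)%:E)%E.
Proof.
move=> mA; rewrite fineK// ge0_fin_numE ?mass_ltoo//.
by apply: integral_ge0 => u _; rewrite lee_fin expR_ge0.
Qed.

Lemma tilted_ge0 n y A : 0 <= tilted n y A.
Proof. by apply: fine_ge0; apply: integral_ge0 => u _; rewrite lee_fin expR_ge0. Qed.

Lemma tilted_gt0 n y A : measurable A -> (0 < mu (D `&` A))%E -> 0 < tilted n y A.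
Proof.
move=> mA A0; rewrite -lte_fin tiltedE//; apply: integral_pos_gt0 => //.
- by apply: measurableI => //; exact: measurable_D.
- by apply: measurable_funTS; exact: measurable_weight.
- by move=> u _; exact: weight_gt0.
Qed.

Lemma measurable_tilted {d} {T : measurableType d} n A (f : T -> R) :
  measurable A -> measurable_fun setT f ->
  measurable_fun setT (fun t => tilted n (f t) A).
Proof.
move=> mA mf; apply: (measurableT_comp (fine_measurable measurableT)) => //.
pose g (z : R * R) := (weight n z.1 z.2 * \1_(D `&` A) z.2)%:E.
rewrite (_ : (fun x : T => _) = fubini_F mu g \o f); last first.
  by apply/funext => t; rewrite /mass integral_setE.
apply: measurableT_comp => //; apply: measurable_fun_fubini_tonelli_F.
- apply/measurable_EFinP; apply: measurable_funM.
    by apply: measurable_weight; [exact: measurable_fst|exact: measurable_snd].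
  apply: measurableT_comp; last exact: measurable_snd.
  by apply: measurable_indic; apply: measurableI => //; exact: measurable_D.
- by move=> z; rewrite lee_fin mulr_ge0// ltW// weight_gt0.
Qed.

Lemma tilted_setU n y A B : measurable A -> measurable B -> [disjoint A & B] ->
  tilted n y (A `|` B) = tilted n y A + tilted n y B.
Proof.
move=> mA mB /disj_setPS AB; apply/EFin_inj; rewrite EFinD !tiltedE//; last exact: measurableU.
rewrite setIUr ge0_integral_setU//.
- by apply: measurableI => //; exact: measurable_D.
- by apply: measurableI => //; exact: measurable_D.
- by apply: measurable_funTS; apply/measurable_EFinP; exact: measurable_weight.
- by move=> u _; rewrite lee_fin ltW// weight_gt0.
- by apply/disj_setPS => u [[_ Au] [_ Bu]]; exact: AB.
Qed.

(* Tonelli's theorem and [weightS]: averaging the updated mass over the next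
   observation averages the observation under each parameter. *)
Lemma integral_tilted n y A (phi : R -> R) : measurable A ->
  measurable_fun setT phi -> (forall x, 0 <= phi x) ->
  (\int[nu]_x (phi x * tilted n.+1 (y + x) A)%:E =
   \int[mu]_(u in D `&` A) ((weight n y u)%:E *
     \int[nu]_x (phi x * density nu u x)%:E))%E.
Proof.
move=> mA mphi phi0.
have mDA : measurable (D `&` A) by apply: measurableI => //; exact: measurable_D.
pose g (z : R * R) := (phi z.1 * weight n.+1 (y + z.1) z.2 * \1_(D `&` A) z.2)%:E.
have mg : measurable_fun setT g.
  apply/measurable_EFinP; apply: measurable_funM.
    apply: measurable_funM; first by apply: measurableT_comp => //; exact: measurable_fst.
    apply: measurable_weight; last exact: measurable_snd.
    by apply: measurable_funD => //; exact: measurable_fst.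
  by apply: measurableT_comp; [exact: measurable_indic|exact: measurable_snd].
have g0 z : (0 <= g z)%E.
  by rewrite lee_fin !mulr_ge0// ltW// weight_gt0.
transitivity (\int[nu]_x \int[mu]_u g (x, u))%E.
  apply: eq_integral => x _; rewrite EFinM tiltedE// integral_setE.
  rewrite -ge0_integralZl//.
  - by apply: eq_integral => u _; rewrite /g/= !EFinM muleA.
  - apply/measurable_EFinP; apply: measurable_funM; last exact: measurable_indic.
    exact: measurable_weight.
  - by move=> u _; rewrite lee_fin mulr_ge0// ltW// weight_gt0.
  - by rewrite lee_fin.
rewrite (fubini_tonelli g)// [RHS]integral_setE; apply: eq_integral => u _ /=.
rewrite muleAC -EFinM -ge0_integralZl//.
- by apply: eq_integral => x _; rewrite /g/= weightS -EFinM; congr (_%:E); ring.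
- apply/measurable_EFinP; apply: measurable_funM => //.
  exact: (measurable_density (measurable_cst u)).
- by move=> x _; rewrite lee_fin mulr_ge0// ltW// density_gt0.
- by rewrite lee_fin mulr_ge0// ltW// weight_gt0.
Qed.

Lemma measurable_hi : measurable hi.
Proof. by rewrite -set_itvoy; exact: measurable_itv. Qed.

Lemma measurable_lo : measurable lo.
Proof. by rewrite -set_itvNyc; exact: measurable_itv. Qed.

Lemma mu_Splus_hi : mu (Splus mu theta0) = mu hi.
Proof.
rewrite [RHS](probability_null_setC (measurable_msupport mu) (msupport_setC0 mu)).
  by rewrite setIC.
exact: measurable_hi.
Qed.

Lemma mu_hi_gt0 : (0 < mu (D `&` hi))%E.
Proof.
rewrite setIC -(probability_null_setC measurable_D mu_DC0 measurable_hi) -mu_Splus_hi.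
by have /andP[] := prior_Splus M.
Qed.

Lemma mu_lo_gt0 : (0 < mu (D `&` lo))%E.
Proof.
rewrite setIC -(probability_null_setC measurable_D mu_DC0 measurable_lo).
have -> : lo = ~` hi by apply/seteqP; split => u /=; [rewrite leNgt => /negP|move=> /negP; rewrite -leNgt].
rewrite probability_setC; last exact: measurable_hi.
by rewrite sube_gt0 -mu_Splus_hi; have /andP[] := prior_Splus M.
Qed.

Lemma tilted_hi_gt0 n y : 0 < tilted n y hi.
Proof. by apply: tilted_gt0; [exact: measurable_hi|exact: mu_hi_gt0]. Qed.

Lemma tilted_lo_gt0 n y : 0 < tilted n y lo.
Proof. by apply: tilted_gt0; [exact: measurable_lo|exact: mu_lo_gt0]. Qed.

Lemma tilted_setT n y : tilted n y setT = tilted n y hi + tilted n y lo.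
Proof.
rewrite -tilted_setU; [|exact: measurable_hi|exact: measurable_lo|].
  congr (tilted _ _ _); apply/seteqP; split => // u _ /=.
  by case: (ltP theta0 u) => h; [left|right].
by apply/disj_setPS => u [/= h1 h2]; have := lt_le_trans h1 h2; rewrite ltxx.
Qed.

Lemma tilted_setT_gt0 n y : 0 < tilted n y setT.
Proof. by rewrite tilted_setT addr_gt0// ?tilted_hi_gt0 ?tilted_lo_gt0. Qed.

(** * The posterior probability as an increasing bijection of the state *)

Lemma qE n y : qq n y = tilted n y hi / tilted n y setT.
Proof.
rewrite /q /tilted /Splus mass_setI; last exact: measurable_hi.
congr (_ / fine _); by rewrite -mass_setI// setIT.
Qed.

Lemma onem_qE n y : 1 - qq n y = tilted n y lo / tilted n y setT.
Proof.
rewrite qE -[1](@divff _ (tilted n y setT)) ?gt_eqF ?tilted_setT_gt0//.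
by rewrite -mulrBl tilted_setT addrAC subrr add0r.
Qed.

Lemma q01 n y : 0 < qq n y < 1.
Proof.
rewrite -[X in _ && X]subr_gt0 onem_qE qE.
by rewrite divr_gt0 ?tilted_hi_gt0 ?tilted_setT_gt0//= divr_gt0 ?tilted_lo_gt0 ?tilted_setT_gt0.
Qed.

(** Once the value of the tilt at [theta0] is split off, the remaining factor lies on one side of 1
    for all [u > theta0] and on the other for all [u < theta0]. Monotonicity and limits of [q] all
    come from this. *)
Lemma weight_shift n y1 y2 u :
  weight n y2 u = expR (theta0 * (y2 - y1)) * expR ((u - theta0) * (y2 - y1)) * weight n y1 u.
Proof. by rewrite /weight -!expRD; congr expR; ring. Qed.

Lemma tilted_hi_lt n y1 y2 : y1 < y2 ->
  expR (theta0 * (y2 - y1)) * tilted n y1 hi < tilted n y2 hi.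
Proof.
move=> y12; set c := expR _.
have mDh : measurable (D `&` hi) by apply: measurableI; [exact: measurable_D|exact: measurable_hi].
have mw y : measurable_fun (D `&` hi) (weight n y).
  by apply: measurable_funTS; exact: measurable_weight.
pose r u := weight n y2 u - c * weight n y1 u.
have r0 u : (D `&` hi) u -> 0 < r u.
  move=> [_ /= hu]; rewrite /r (weight_shift n y1 y2) -/c -mulrA -mulrBr.
  rewrite mulr_gt0 ?expR_gt0// -[X in _ - X]mul1r -mulrBl mulr_gt0 ?weight_gt0//.
  by rewrite subr_gt0 expR_gt1 mulr_gt0 ?subr_gt0.
have mr : measurable_fun (D `&` hi) r.
  by apply: measurable_funB => //; apply: measurable_funM.
rewrite -lte_fin EFinM !tiltedE; [|exact: measurable_hi|exact: measurable_hi].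
have -> : (\int[mu]_(u in D `&` hi) (weight n y2 u)%:E =
    c%:E * \int[mu]_(u in D `&` hi) (weight n y1 u)%:E + \int[mu]_(u in D `&` hi) (r u)%:E)%E.
  rewrite -ge0_integralZl//; [|exact/measurable_EFinP
    |by move=> *; rewrite lee_fin ltW ?weight_gt0|by rewrite lee_fin expR_ge0].
  rewrite -ge0_integralD//.
  - by apply: eq_integral => u _; rewrite -EFinM -EFinD /r addrC subrK.
  - by move=> u _; rewrite -EFinM lee_fin mulr_ge0 ?expR_ge0.
  - by apply: measurable_funeM; exact/measurable_EFinP.
  - by move=> u /r0 ru; rewrite lee_fin ltW.
  - exact/measurable_EFinP.
rewrite -tiltedE; last exact: measurable_hi.
by rewrite -EFinM lteDl//; apply: integral_pos_gt0 => //; exact: mu_hi_gt0.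
Qed.

Lemma tilted_lo_le n y1 y2 : y1 <= y2 ->
  tilted n y2 lo <= expR (theta0 * (y2 - y1)) * tilted n y1 lo.
Proof.
move=> y12; rewrite -lee_fin EFinM !tiltedE; [|exact: measurable_lo|exact: measurable_lo].
have mDl : measurable (D `&` lo) by apply: measurableI; [exact: measurable_D|exact: measurable_lo].
have mw y : measurable_fun (D `&` lo) (weight n y).
  by apply: measurable_funTS; exact: measurable_weight.
rewrite -ge0_integralZl//; [|exact/measurable_EFinP|by move=> *; rewrite lee_fin ltW ?weight_gt0].
apply: ge0_le_integral => //.
- by move=> u _; rewrite lee_fin ltW ?weight_gt0.
- exact/measurable_EFinP.
- by apply: measurable_funeM; exact/measurable_EFinP.
- move=> u [_ /= hu]; rewrite -EFinM lee_fin (weight_shift n y1 y2) -mulrA.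
  apply: ler_wpM2l; first exact: expR_ge0.
  apply: ler_piMl; first by rewrite ltW// weight_gt0.
  by rewrite expR_le1 mulr_le0_ge0 ?subr_le0 ?subr_ge0.
Qed.

(** The upper mass grows by more than the factor [c] and the lower mass by at most [c], so the odds
    increase strictly. *)
Lemma q_lt n y1 y2 : y1 < y2 -> qq n y1 < qq n y2.
Proof.
move=> y12; rewrite !qE ltr_pdivrMr ?tilted_setT_gt0// mulrAC ltr_pdivlMr ?tilted_setT_gt0//.
rewrite !tilted_setT.
have h1 := tilted_hi_lt n y12; have h2 := tilted_lo_le n (ltW y12).
have := tilted_hi_gt0 n y1; have := tilted_lo_gt0 n y1.
have := tilted_lo_gt0 n y2; have := expR_gt0 (theta0 * (y2 - y1)).
move: h1 h2; set c := expR _; set a := tilted n y1 hi; set b := tilted n y2 hi.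
set s := tilted n y1 lo; set t := tilted n y2 lo => h1 h2 c0 t0 s0 a0.
clearbody c a b s t.
have : a * t <= a * (c * s) by rewrite ler_pM2l.
have : s * (c * a) < s * b by rewrite ltr_pM2l.
by lra.
Qed.

Lemma q_le n y1 y2 : y1 <= y2 -> qq n y1 <= qq n y2.
Proof. by rewrite le_eqVlt => /orP[/eqP->//|/(q_lt n)/ltW]. Qed.

Lemma q_inj n : injective (qq n).
Proof.
move=> y1 y2 e; apply/eqP; case: (ltgtP y1 y2) => [/(q_lt n)|/(q_lt n)|//];
  by rewrite e ltxx.
Qed.

Lemma measurable_q {d} {T : measurableType d} n (f : T -> R) :
  measurable_fun setT f -> measurable_fun setT (fun t => qq n (f t)).
Proof.
move=> mf; apply: (measurableT_comp _ mf).
by apply: nondecreasing_measurable => // y1 y2; exact: q_le.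
Qed.

Lemma integrable_weight n y A : measurable A ->
  mu.-integrable (D `&` A) (EFin \o weight n y).
Proof.
move=> mA; apply/integrableP; split.
  by apply: measurable_funTS; apply/measurable_EFinP; exact: measurable_weight.
apply: le_lt_trans (mass_ltoo n y mA).
rewrite /mass le_eqVlt; apply/orP; left; apply/eqP; apply: eq_integral => u _ /=.
by rewrite ger0_norm// expR_ge0.
Qed.

Lemma continuous_tilted n A : measurable A -> continuous (fun y => tilted n y A).
Proof.
move=> mA y0.
have mDA : measurable (D `&` A) by apply: measurableI => //; exact: measurable_D.
(* For [y] in the window of radius 1, the weight at [u] is bounded by the one at the right or left
   end according to the sign of [u]; the sum covers both cases. *)
pose g u := weight n (y0 + 1) u + weight n (y0 - 1) u.
apply: (@continuity_under_integral _ _ _ mu (weight n) (D `&` A) mDA (y0 - 1) (y0 + 1) _ _ g).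
- by move=> y _; exact: integrable_weight.
- apply: aeW => u _ y _.
  apply: continuous_comp; last exact: continuous_expR.
  apply: cvgB; last exact: cvg_cst.
  exact: mulrl_continuous.
- rewrite (_ : EFin \o g = (EFin \o weight n (y0 + 1)) \+ (EFin \o weight n (y0 - 1)))%E//.
  by apply: integrableD => //; exact: integrable_weight.
- move=> y /=; rewrite in_itv/= => /andP[y1 y2]; apply: aeW => u _.
  rewrite ger0_norm ?expR_ge0// /g.
  have [u0|u0] := leP 0 u.
    by rewrite ler_wpDr ?expR_ge0// ler_expR lerD2r ler_wpM2l// ltW.
  by rewrite ler_wpDl ?expR_ge0// ler_expR lerD2r ler_wnM2l// ltW.
- by rewrite inE/= in_itv/=; lra.
Qed.

Lemma continuous_q n : continuous (qq n).
Proof.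
move=> y; rewrite (_ : qq n = fun y => tilted n y hi / tilted n y setT); last first.
  by apply/funext => z; exact: qE.
apply: cvgM; first by apply: continuous_tilted; exact: measurable_hi.
by apply: cvgV; [rewrite gt_eqF// tilted_setT_gt0|exact: continuous_tilted].
Qed.

(** Take [y = -k]. After rescaling by [expR (theta0 * k)], the upper mass tends to 0 by dominated
    convergence while the lower mass stays at least [tilted n 0 lo]. *)
Lemma q_small n p : 0 < p < 1 -> exists y, qq n y < p.
Proof.
move=> p01.
have mDh : measurable (D `&` hi).
  by apply: measurableI; [exact: measurable_D|exact: measurable_hi].
pose f (k : nat) u := (expR ((u - theta0) * - k%:R) * weight n 0 u)%:E.
have fE k u : f k u = (expR (theta0 * k%:R) * weight n (- k%:R) u)%:E.
  rewrite /f (weight_shift n 0 (- k%:R)) subr0 !mulrA -expRD -mulrDr subrr mulr0.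
  by rewrite expR0 mul1r.
have cvg0 : (\int[mu]_(u in D `&` hi) f k u @[k --> \oo] --> 0)%E.
  rewrite -(@integral0 _ _ _ mu (D `&` hi)).
  apply: (@dominated_cvg _ _ _ mu (D `&` hi) mDh f (cst 0%E) (EFin \o weight n 0)).
  - move=> k; apply: measurable_funTS; apply/measurable_EFinP.
    apply: measurable_funM; last exact: measurable_weight.
    apply: measurableT_comp; first exact: measurable_expR.
    by apply: measurable_funM => //; exact: measurable_funB.
  - move=> u [_ /= hu]; apply/fine_cvgP; split; first exact: nearW.
    rewrite /comp/= -[X in _ --> X](mul0r (weight n 0 u)).
    apply: cvgM; last exact: cvg_cst.
    under eq_fun do rewrite mulrN -mulNr expRM_natr.
    apply: cvg_expr; rewrite ger0_norm ?expR_ge0// expR_lt1.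
    by rewrite oppr_lt0 subr_gt0.
  - by [].
  - by apply: integrable_weight; exact: measurable_hi.
  - move=> k u [_ /= hu]; rewrite /f/= lee_fin ger0_norm; last by rewrite mulr_ge0 ?expR_ge0.
    rewrite ler_piMl ?expR_ge0// expR_le1.
    by rewrite mulr_ge0_le0 ?oppr_le0// subr_ge0 ltW.
have hE k : (\int[mu]_(u in D `&` hi) f k u =
    (expR (theta0 * k%:R) * tilted n (- k%:R) hi)%:E)%E.
  rewrite EFinM tiltedE; last exact: measurable_hi.
  rewrite -ge0_integralZl//.
  - by apply: eq_integral => u _; rewrite fE EFinM.
  - by apply: measurable_funTS; apply/measurable_EFinP; exact: measurable_weight.
  - by move=> u _; rewrite lee_fin expR_ge0.
have pos : 0 < p * tilted n 0 lo.
  by rewrite mulr_gt0 ?tilted_lo_gt0//; have /andP[] := p01.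
move: cvg0; under eq_fun do rewrite hE.
move=> /fine_cvgP[_ /cvgr_lt /(_ _ pos)].
move=> [k _ /(_ k (leqnn k))] /= hk; exists (- k%:R).
have kle : - k%:R <= 0 :> R by rewrite oppr_le0 ler0n.
have := tilted_lo_le n kle; rewrite sub0r opprK => lok.
rewrite qE ltr_pdivrMr; last exact: tilted_setT_gt0.
rewrite tilted_setT.
rewrite -(ltr_pM2l (expR_gt0 (theta0 * k%:R))).
have hi0 := tilted_hi_gt0 n (- k%:R).
move: hk lok hi0 (expR_gt0 (theta0 * k%:R)).
set c := expR _; set a := tilted n _ hi; set b := tilted n _ lo; set b0 := tilted n 0 lo.
by move=> h1 h2 a0 c0; have := mulr_gt0 c0 a0; nra.
Qed.

(** This is not the mirror image of [q_small]: [lo] contains [theta0], where the rescaled weight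
    does not decay, so the lower mass need not vanish. Instead it stays bounded while the upper mass
    grows at least linearly in [k], since [expR x >= 1 + x]. The rate is the integral of
    [(u - theta0) * weight n 0 u], which is finite by the same bound at [k = 1]. *)
Lemma q_large n p : 0 < p < 1 -> exists y, p < qq n y.
Proof.
move=> p01.
have mDh : measurable (D `&` hi).
  by apply: measurableI; [exact: measurable_D|exact: measurable_hi].
pose g u := (u - theta0) * weight n 0 u.
have mg : measurable_fun (D `&` hi) g.
  apply: measurable_funTS; apply: measurable_funM; last exact: measurable_weight.
  exact: measurable_funB.
have mw y : measurable_fun (D `&` hi) (fun u => (weight n y u)%:E).
  by apply: measurable_funTS; apply/measurable_EFinP; exact: measurable_weight.
pose kE := (\int[mu]_(u in D `&` hi) (g u)%:E)%E.
have g0 u : (D `&` hi) u -> 0 < g u.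
  by move=> [_ /= hu]; rewrite mulr_gt0 ?subr_gt0 ?expR_gt0.
have bound k : (k%:R%:E * kE <= (expR (- (theta0 * k%:R)) * tilted n k%:R hi)%:E)%E.
  rewrite EFinM tiltedE; last exact: measurable_hi.
  rewrite -!ge0_integralZl//.
  - apply: ge0_le_integral => //.
    + by move=> u /g0 gu; rewrite -EFinM lee_fin mulr_ge0// ltW.
    + by apply: measurable_funeM; exact/measurable_EFinP.
    + by apply: measurable_funeM.
    + move=> u [_ /= hu]; rewrite -!EFinM lee_fin (weight_shift n 0 k%:R) subr0.
      rewrite !mulrA -expRD addNr expR0 mul1r.
      rewrite ler_wpM2r ?expR_ge0// mulrC.
      by apply: le_trans (expR_ge1Dx _); rewrite lerDr.
  - by move=> u _; rewrite lee_fin expR_ge0.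
  - exact/measurable_EFinP.
  - by move=> u /g0 gu; rewrite lee_fin ltW.
have kfin : kE \is a fin_num.
  rewrite ge0_fin_numE; last by apply: integral_ge0 => u /g0 gu; rewrite lee_fin ltW.
  by have := bound 1%N; rewrite mul1e => /le_lt_trans; apply; exact: ltry.
have k0 : 0 < fine kE.
  rewrite fine_gt0//; apply/andP; split; last first.
    by rewrite -ge0_fin_numE// integral_ge0// => u /g0 gu; rewrite lee_fin ltW.
  by apply: integral_pos_gt0 => //; exact: mu_hi_gt0.
have q0 : 0 < (1 - p) * fine kE by rewrite mulr_gt0//; lra.
pose k := Num.bound (p * tilted n 0 lo / ((1 - p) * fine kE)).
have hk : p * tilted n 0 lo < k%:R * ((1 - p) * fine kE).
  rewrite -ltr_pdivrMr//; apply: le_lt_trans (archi_boundP _); first by [].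
  by rewrite divr_ge0 ?mulr_ge0 ?tilted_ge0// ltW//; lra.
exists k%:R.
have := tilted_lo_le n (ler0n R k); rewrite subr0 => lok.
have := bound k; rewrite -(fineK kfin) -EFinM lee_fin => bk.
rewrite qE ltr_pdivlMr; last exact: tilted_setT_gt0.
rewrite tilted_setT.
rewrite -(ltr_pM2l (expR_gt0 (- (theta0 * k%:R)))).
have : expR (- (theta0 * k%:R)) * tilted n k%:R lo <= tilted n 0 lo.
  rewrite -(ler_pM2l (expR_gt0 (theta0 * k%:R))) mulrA -expRD subrr expR0 mul1r.
  exact: lok.
move: hk bk; set c := expR _; set a := tilted n k%:R hi; set b := tilted n k%:R lo.
set b0 := tilted n 0 lo; set kap := fine kE => h1 h2 h3.
have := ler_wpM2l (_ : 0 <= p) h3; have := ler_wpM2l (_ : 0 <= 1 - p) h2.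
by move=> /(_ ltac:(lra)) + /(_ ltac:(lra)); lra.
Qed.

Lemma q_surj n p : 0 < p < 1 -> exists y, qq n y = p.
Proof.
move=> p01; have [a qa] := q_small n p01; have [b qb] := q_large n p01.
have ab : a <= b.
  rewrite leNgt; apply/negP => /(q_lt n) ba.
  by have := lt_trans qb (lt_trans ba qa); rewrite ltxx.
have [||y _ yE] := @IVT R (qq n) a b p ab.
- by apply: continuous_subspaceT; exact: continuous_q.
- by rewrite min_l ?max_r ?q_le// !ltW.
by exists y.
Qed.

Lemma q_yinv n p : 0 < p < 1 -> qq n (yy n p) = p.
Proof. by move=> /(q_surj n)[y yE]; rewrite /yinv; case: xgetP => [_ _ //|/(_ y)]. Qed.

Lemma yinv_q n y : yy n (qq n y) = y.
Proof. by apply: (@q_inj n); rewrite q_yinv// q01. Qed.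

(* Density with respect to [nu] of the next observation in state [(n, y)]. *)
Definition predictive (n : nat) (y x : R) : R :=
  tilted n.+1 (y + x) setT / tilted n y setT.

(** Analytic form of the expectation of [f] at the next posterior probability from the state
    [(n, y)]; [next_mean_conditional] identifies it with a conditional expectation under [P]. *)
Definition next_mean (n : nat) (f : R -> R) (y : R) : R :=
  fine (\int[nu]_x (f (qq n.+1 (y + x)) * predictive n y x)%:E).

(** The class preserved by backward induction: concavity provides supporting lines, and the upper
    bound keeps their values at 0 and 1 within [0, 1]. *)
Definition admissible (f : R -> R) : Prop :=
  (forall p, 0 < p < 1 -> 0 <= f p <= Num.min p (1 - p)) /\ concave01 f.

Lemma predictive_gt0 n y x : 0 < predictive n y x.
Proof. by rewrite divr_gt0// tilted_setT_gt0. Qed.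

(** Monotone likelihood ratio: [density v / density u] is the exponential of an affine function of
    [x] with slope [v - u], so the densities cross once. The factor [v - u] in the hypothesis covers
    nonincreasing [phi] when [u < v] and nondecreasing [phi] when [v < u]. *)
Lemma integral_density_le u v (phi : R -> R) : D u -> D v ->
  measurable_fun setT phi -> (forall x, 0 <= phi x <= 1) ->
  (forall x z, (v - u) * x < (v - u) * z -> phi z <= phi x) ->
  (\int[nu]_x (phi x * density nu v x)%:E <= \int[nu]_x (phi x * density nu u x)%:E)%E.
Proof.
move=> Du Dv mphi phi01 mono.
have md s : measurable_fun setT (density nu s).
  by apply: measurable_density; [exact: measurable_cst|exact: measurable_id].
apply: (@integral_le_of_crossing _ _ _ nu setT (density nu v) (density nu u) phi).
- exact: measurableT.
- exact: md.
- exact: md.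
- exact: mphi.
- by move=> x _; rewrite ltW// density_gt0.
- by move=> x _; rewrite ltW// density_gt0.
- by move=> x _; exact: phi01.
- by transitivity (1%E : \bar R); [exact: integral_density|exact/esym/integral_density].
- by rewrite (integral_density Dv) ltry.
- by move=> x z _ _; rewrite ler_expR ltr_expR => h1 h2; apply: mono; lra.
Qed.

Lemma expR_chord_le (a l u v : R) : 0 <= l <= 1 ->
  expR ((l * u + (1 - l) * v) * a) <= l * expR (u * a) + (1 - l) * expR (v * a).
Proof.
move=> /andP[l0 l1]; set t := l * u + _.
have h z : expR (t * a) * (1 + (z - t) * a) <= expR (z * a).
  have -> : z * a = t * a + (z - t) * a by ring.
  by rewrite expRD ler_pM2l ?expR_gt0// expR_ge1Dx.
have := ler_wpM2l l0 (h u); have := ler_wpM2l (_ : 0 <= 1 - l) (h v).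
rewrite subr_ge0 => /(_ l1) hv hu.
have : l * (expR (t * a) * (1 + (u - t) * a)) + (1 - l) * (expR (t * a) * (1 + (v - t) * a))
    = expR (t * a) by rewrite /t; ring.
by move: hu hv; set e := expR _; lra.
Qed.

(** A nonnegative combination of exponentials is convex, so its sublevel sets are intervals; [l] is
    the barycentric coordinate of [t] between [u] and [v]. *)
Lemma expR_comb_quasiconvex (c1 c2 a1 a2 c u t v : R) : 0 <= c1 -> 0 <= c2 ->
  u < t < v ->
  c1 * expR (u * a1) + c2 * expR (u * a2) <= c ->
  c1 * expR (v * a1) + c2 * expR (v * a2) <= c ->
  c1 * expR (t * a1) + c2 * expR (t * a2) <= c.
Proof.
move=> c10 c20 /andP[ut tv] hu hv; pose l := (v - t) / (v - u).
have l0 : 0 <= l by rewrite divr_ge0; lra.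
have l1 : l <= 1 by rewrite ler_pdivrMr; lra.
have l01 : 0 <= l <= 1 by rewrite l0.
have tE : t = l * u + (1 - l) * v by rewrite /l; field; lra.
have h1 := ler_wpM2l c10 (expR_chord_le a1 u v l01).
have h2 := ler_wpM2l c20 (expR_chord_le a2 u v l01).
rewrite -tE in h1 h2.
have := ler_wpM2l l0 hu; have := ler_wpM2l (_ : 0 <= 1 - l) hv.
rewrite subr_ge0 => /(_ l1).
move: h1 h2; set x1 := expR _; set x2 := expR _; set x3 := expR _.
set x4 := expR _; set x5 := expR _; set x6 := expR _.
by lra.
Qed.

Lemma integral_lt_pos (A : set R) (a b : R -> R) : measurable A -> (0 < mu A)%E ->
  measurable_fun A a -> measurable_fun A b -> (forall u, A u -> 0 <= b u) ->
  (forall u, A u -> b u < a u) -> (\int[mu]_(u in A) (b u)%:E < +oo)%E ->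
  (\int[mu]_(u in A) (b u)%:E < \int[mu]_(u in A) (a u)%:E)%E.
Proof.
move=> mA A0 ma mb b0 ba bfin.
have mab : measurable_fun A (fun u => a u - b u) by exact: measurable_funB.
have -> : (\int[mu]_(u in A) (a u)%:E =
    \int[mu]_(u in A) (b u)%:E + \int[mu]_(u in A) (a u - b u)%:E)%E.
  rewrite -ge0_integralD//.
  - by apply: eq_integral => u _; rewrite -EFinD addrC subrK.
  - exact/measurable_EFinP.
  - by move=> u /ba bau; rewrite lee_fin subr_ge0 ltW.
  - exact/measurable_EFinP.
rewrite lteDl.
  by apply: integral_pos_gt0 => // u /ba; rewrite subr_gt0.
by rewrite ge0_fin_numE//; apply: integral_ge0 => u /b0; rewrite lee_fin.
Qed.

Lemma integral_predictive n y : (\int[nu]_x (predictive n y x)%:E = 1)%E.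
Proof.
have m0 := tilted_setT_gt0 n y.
have md (s : R) : measurable_fun setT (density nu s).
  by apply: measurable_density; [exact: measurable_cst|exact: measurable_id].
transitivity ((tilted n y setT)^-1%:E * \int[nu]_x (cst 1 x * tilted n.+1 (y + x) setT)%:E)%E.
  rewrite -ge0_integralZl//.
  - by apply: eq_integral => x _; rewrite -EFinM /predictive/= mul1r mulrC.
  - apply/measurable_EFinP; apply: measurable_funM => //.
    by apply: measurable_tilted => //; exact: measurable_funD.
  - by move=> x _; rewrite lee_fin mul1r tilted_ge0.
  - by rewrite lee_fin invr_ge0 tilted_ge0.
rewrite (@integral_tilted n y setT (cst 1))//.
rewrite (_ : integral _ _ _ = (tilted n y setT)%:E).
  by rewrite -EFinM mulVf ?gt_eqF.
rewrite tiltedE//; apply: eq_integral => u /set_mem[Du _].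
under eq_integral do rewrite mul1r.
by rewrite integral_density// mule1.
Qed.

(** Measurability of [f] comes from concavity: [f] composed with [q] is expressed through [q] and
    the values of the supporting lines, all monotone in the state. *)
Lemma measurable_admissible_q {d} {T : measurableType d} n (f : R -> R) (g : T -> R) :
  admissible f -> measurable_fun setT g ->
  measurable_fun setT (fun t => f (qq n (g t))).
Proof.
move=> [_ /supporting_linesP[t1 [t0 tl]]] mg.
apply: (measurableT_comp (_ : measurable_fun setT (fun y => f (qq n y))) mg).
have -> : (fun y => f (qq n y)) =
    (fun y => qq n y * t1 (qq n y) + (1 - qq n y) * t0 (qq n y)).
  by apply/funext => y; have [] := tl _ _ (q01 n y) (q01 n y).
have mq := @measurable_q _ _ n id (@measurable_id _ _ setT).
have mono y z (yz : y <= z) :=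
  supporting_lines_mono tl (q01 n y) (q01 n z) (q_le n yz).
apply: measurable_funD; apply: measurable_funM => //.
- by apply: nonincreasing_measurable => // y z yz; have [] := mono y z yz.
- exact: measurable_funB.
- by apply: nondecreasing_measurable => // y z yz; have [] := mono y z yz.
Qed.

Lemma next_meanE n f y : admissible f ->
  ((next_mean n f y)%:E = \int[nu]_x (f (qq n.+1 (y + x)) * predictive n y x)%:E)%E.
Proof.
move=> af; rewrite fineK//.
have f0 x : 0 <= f (qq n.+1 (y + x)) by have /andP[] := af.1 _ (q01 n.+1 (y + x)).
have p0 x : 0 <= predictive n y x by rewrite ltW// predictive_gt0.
have mp : measurable_fun setT (predictive n y).
  apply: measurable_funM => //; apply: measurable_tilted => //.
  exact: measurable_funD.
rewrite ge0_fin_numE; last by apply: integral_ge0 => x _; rewrite lee_fin mulr_ge0.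
apply: (@le_lt_trans _ _ (\int[nu]_x (predictive n y x)%:E)%E); last first.
  by rewrite integral_predictive ltry.
apply: ge0_le_integral => //.
- by move=> x _; rewrite lee_fin mulr_ge0.
- apply/measurable_EFinP; apply: measurable_funM => //.
  by apply: measurable_admissible_q => //; exact: measurable_funD.
- exact/measurable_EFinP.
- move=> x _; rewrite lee_fin ler_piMl//.
  have /andP[_ h] := af.1 _ (q01 n.+1 (y + x)); apply: le_trans h _.
  by rewrite ge_min (ltW (proj2 (andP (q01 n.+1 (y + x))))).
Qed.

Definition param_mean (phi : R -> R) (u : R) : R :=
  fine (\int[nu]_x (phi x * density nu u x)%:E).

Lemma weight_tilt n y y' u : weight n y u = expR (u * (y - y')) * weight n y' u.
Proof. by rewrite /weight -expRD; congr expR; ring. Qed.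

(* Otherwise [done] unfolds these constants when it looks for signs. *)
Local Opaque weight tilted density q.

Section param_mean.
Variable phi : R -> R.
Hypotheses (mphi : measurable_fun setT phi) (phi01 : forall x, 0 <= phi x <= 1).

Let phi0 x : 0 <= phi x. Proof. by have /andP[] := phi01 x. Qed.

Lemma param_mean_le1 u : D u ->
  (\int[nu]_x (phi x * density nu u x)%:E <= 1)%E.
Proof.
move=> Du; rewrite -(integral_density Du).
have md : measurable_fun setT (density nu u).
  by apply: measurable_density; [exact: measurable_cst|exact: measurable_id].
apply: ge0_le_integral => //.
- by move=> x _; rewrite lee_fin mulr_ge0// ltW// density_gt0.
- by apply/measurable_EFinP; exact: measurable_funM.
- exact/measurable_EFinP.
- move=> x _; rewrite lee_fin ler_piMl//; first by rewrite ltW// density_gt0.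
  by have /andP[] := phi01 x.
Qed.

Let param_mean_fin u : D u ->
  (\int[nu]_x (phi x * density nu u x)%:E)%E \is a fin_num.
Proof.
move=> Du; rewrite ge0_fin_numE; first by apply: le_lt_trans (param_mean_le1 Du) _; rewrite ltry.
by apply: integral_ge0 => x _; rewrite lee_fin mulr_ge0// ltW// density_gt0.
Qed.

Lemma param_meanE u : D u ->
  ((param_mean phi u)%:E = \int[nu]_x (phi x * density nu u x)%:E)%E.
Proof. by move=> /param_mean_fin/fineK. Qed.

Lemma param_mean_le u v : D u -> D v ->
  (forall x z, (v - u) * x < (v - u) * z -> phi z <= phi x) ->
  param_mean phi v <= param_mean phi u.
Proof.
move=> Du Dv mono; apply: fine_le; [exact: param_mean_fin|exact: param_mean_fin|].
exact: integral_density_le.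
Qed.

Lemma param_mean01 u : D u -> 0 <= param_mean phi u <= 1.
Proof.
move=> Du; rewrite -!lee_fin param_meanE// param_mean_le1// andbT.
by apply: integral_ge0 => x _; rewrite lee_fin mulr_ge0// ltW// density_gt0.
Qed.

Lemma measurable_param_mean : measurable_fun setT (param_mean phi).
Proof.
apply: (measurableT_comp (fine_measurable measurableT)).
apply: (measurable_fun_fubini_tonelli_F (fun z : R * R => (phi z.2 * density nu z.1 z.2)%:E)).
- apply/measurable_EFinP; apply: measurable_funM.
    by apply: measurableT_comp => //; exact: measurable_snd.
  by apply: measurable_density; [exact: measurable_fst|exact: measurable_snd].
- by move=> z; rewrite lee_fin mulr_ge0// ltW// density_gt0.
Qed.

(** Both sides are the mean of [phi] at the next observation on the event that the parameter is in
    [A], computed by conditioning on the observation and on the parameter respectively. *)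
Lemma integral_tilted_mean n y A : measurable A ->
  (\int[nu]_x (phi x * (tilted n.+1 (y + x) A / tilted n y setT))%:E =
   \int[mu]_(u in D `&` A) (param_mean phi u * (weight n y u / tilted n y setT))%:E)%E.
Proof.
move=> mA; have mDA : measurable (D `&` A) by apply: measurableI => //; exact: measurable_D.
have m0 : (0 <= (tilted n y setT)^-1%:E)%E by rewrite lee_fin invr_ge0 tilted_ge0.
transitivity ((tilted n y setT)^-1%:E * \int[nu]_x (phi x * tilted n.+1 (y + x) A)%:E)%E.
  rewrite -ge0_integralZl//.
  - by apply: eq_integral => x _; rewrite -EFinM; congr EFin; ring.
  - apply/measurable_EFinP; apply: measurable_funM => //.
    by apply: measurable_tilted => //; exact: measurable_funD.
  - by move=> x _; rewrite lee_fin mulr_ge0// tilted_ge0.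
rewrite integral_tilted//.
transitivity ((tilted n y setT)^-1%:E *
    \int[mu]_(u in D `&` A) (param_mean phi u * weight n y u)%:E)%E.
  congr (_ * _)%E; apply: eq_integral => u /set_mem[Du _].
  by rewrite -param_meanE// muleC.
rewrite -ge0_integralZl//.
- by apply: eq_integral => u _; rewrite -EFinM; congr EFin; ring.
- apply: measurable_funTS; apply/measurable_EFinP.
  by apply: measurable_funM; [exact: measurable_param_mean|exact: measurable_weight].
- move=> u [Du _]; rewrite lee_fin mulr_ge0//; last by rewrite ltW// weight_gt0.
  by have /andP[] := param_mean01 Du.
Qed.

End param_mean.

End exponential_family.
Arguments weight {R} M n y u.
Arguments tilted {R} M n y A.
Arguments predictive {R} M n y x.
Arguments next_mean {R} M n f y.
Arguments param_mean {R} M phi u.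

(** * Concavity of one-step means *)

Section concavity.
Context {R : realType} {M : bayes_model R}.
Local Notation nu := (obs_measure M).
Local Notation mu := (prior M).
Local Notation theta0 := (threshold M).
Local Notation D := (interior (natural_parameters nu)).
Local Notation hi := ([set u | theta0 < u] : set R).
Local Notation lo := ([set u | u <= theta0] : set R).
Local Notation qq := (q nu mu theta0).
Local Notation yy := (yinv nu mu theta0).
Local Notation weight := (weight M).
Local Notation tilted := (tilted M).
Local Notation predictive := (predictive M).
Local Notation next_mean := (next_mean M).
Local Notation param_mean := (param_mean M).

Lemma integral_weight_ratio n y A : measurable A ->
  (\int[mu]_(u in D `&` A) (weight n y u / tilted n y setT)%:E =
   (tilted n y A / tilted n y setT)%:E)%E.
Proof.
move=> mA; rewrite mulrC EFinM tiltedE// -ge0_integralZl//.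
- by apply: eq_integral => u _; rewrite mulrC EFinM.
- by apply: measurableI => //; exact: measurable_D.
- by apply: measurable_funTS; apply/measurable_EFinP; exact: measurable_weight.
- by move=> u _; rewrite lee_fin ltW// weight_gt0.
- by rewrite lee_fin invr_ge0 tilted_ge0.
Qed.

(** It depends linearly on the posterior density, so a mixture of its values at two states is an
    integral against the mixed density. *)
Definition tangent_mean (n : nat) (Phi1 Phi0 : R -> R) (y : R) : \bar R :=
  (\int[mu]_(u in D `&` hi) (Phi1 u * (weight n y u / tilted n y setT))%:E +
   \int[mu]_(u in D `&` lo) (Phi0 u * (weight n y u / tilted n y setT))%:E)%E.

Section mixture.
Variables (n : nat) (l y1 y0 y2 : R).
Hypothesis l01 : 0 < l < 1.
Hypothesis q_mix : qq n y0 = l * qq n y1 + (1 - l) * qq n y2.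

Let a u := l * (weight n y1 u / tilted n y1 setT)
  + (1 - l) * (weight n y2 u / tilted n y2 setT).
Let b u := weight n y0 u / tilted n y0 setT.
(** Dividing by [weight n y0] turns [b] into the constant [c] and the mixed density [a] into a
    combination of two exponentials in [u], so the sign of [a - b] is that of [g - c]. *)
Let g u := l / tilted n y1 setT * expR (u * (y1 - y0))
  + (1 - l) / tilted n y2 setT * expR (u * (y2 - y0)).
Let c := (tilted n y0 setT)^-1.

Let aE u : a u = g u * weight n y0 u.
Proof.
by rewrite /a /g (weight_tilt n y1 y0) (weight_tilt n y2 y0); ring.
Qed.

Let bE u : b u = c * weight n y0 u. Proof. by rewrite /b /c mulrC. Qed.

Let ab u : (a u <= b u) = (g u <= c).
Proof. by rewrite aE bE ler_pM2r// weight_gt0. Qed.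

Let ba u : (b u < a u) = (c < g u).
Proof. by rewrite aE bE ltr_pM2r// weight_gt0. Qed.

Let l_ge0 : 0 <= l /\ 0 <= 1 - l.
Proof. by have /andP[/ltW l0 /ltW l1] := l01; rewrite subr_ge0. Qed.

Let g_qc u t v : u < t < v -> g u <= c -> g v <= c -> g t <= c.
Proof.
have [l0 l1] := l_ge0.
by apply: expR_comb_quasiconvex; rewrite divr_ge0 ?tilted_ge0.
Qed.

Let mwt y : measurable_fun setT (fun u => weight n y u / tilted n y setT).
Proof. by apply: measurable_funM => //; exact: measurable_weight. Qed.

Let wt_ge0 y u : 0 <= weight n y u / tilted n y setT.
Proof. by rewrite divr_ge0 ?tilted_ge0// ltW// weight_gt0. Qed.

Lemma measurable_mix : measurable_fun setT a.
Proof. by apply: measurable_funD; apply: measurable_funM. Qed.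

Let a_ge0 u : 0 <= a u.
Proof.
have [l0 l1] := l_ge0.
by apply: addr_ge0; apply: mulr_ge0 => //; exact: wt_ge0.
Qed.

Lemma integral_mix A (Phi : R -> R) : measurable A -> measurable_fun setT Phi ->
  (forall u, A u -> 0 <= Phi u) ->
  (\int[mu]_(u in A) (Phi u * a u)%:E =
   l%:E * \int[mu]_(u in A) (Phi u * (weight n y1 u / tilted n y1 setT))%:E +
   (1 - l)%:E * \int[mu]_(u in A) (Phi u * (weight n y2 u / tilted n y2 setT))%:E)%E.
Proof.
move=> mA mPhi Phi0.
have mM y : measurable_fun A (fun u => (Phi u * (weight n y u / tilted n y setT))%:E).
  apply: measurable_funTS; apply/measurable_EFinP; exact: measurable_funM.
have p0 y u : A u -> (0 <= (Phi u * (weight n y u / tilted n y setT))%:E)%E.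
  by move=> Au; rewrite lee_fin; apply: mulr_ge0; [exact: Phi0|exact: wt_ge0].
have mulp r y : 0 <= r -> forall u, A u ->
    (0 <= r%:E * (Phi u * (weight n y u / tilted n y setT))%:E)%E.
  by move=> r0 u Au; apply: mule_ge0; [rewrite lee_fin|exact: p0].
rewrite -(ge0_integralZl _ mA (mM y1) (p0 y1)); last by rewrite lee_fin l_ge0.1.
rewrite -(ge0_integralZl _ mA (mM y2) (p0 y2)); last by rewrite lee_fin l_ge0.2.
rewrite -ge0_integralD.
- apply: eq_integral => u _; rewrite -!EFinM -EFinD; congr EFin; rewrite /a; ring.
- exact: mA.
- exact: mulp l_ge0.1.
- apply: measurable_funeM; exact: mM.
- exact: mulp l_ge0.2.
- apply: measurable_funeM; exact: mM.
Qed.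

Let integral_aE A : measurable A ->
  tilted n y0 A / tilted n y0 setT =
    l * (tilted n y1 A / tilted n y1 setT) + (1 - l) * (tilted n y2 A / tilted n y2 setT) ->
  (\int[mu]_(u in D `&` A) (a u)%:E = \int[mu]_(u in D `&` A) (b u)%:E)%E.
Proof.
move=> mA E.
have mDA : measurable (D `&` A) by apply: measurableI; [exact: measurable_D|exact: mA].
have one (f : R -> R) :
    (\int[mu]_(u in D `&` A) (cst 1%R u * f u)%:E = \int[mu]_(u in D `&` A) (f u)%:E)%E.
  by apply: eq_integral => u _; rewrite mul1r.
have := @integral_mix (D `&` A) (cst 1) mDA (measurable_cst _) (fun u _ => ler01).
rewrite !one => ->.
by rewrite (integral_weight_ratio n y1 mA) (integral_weight_ratio n y2 mA)
  (integral_weight_ratio n y0 mA) E.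
Qed.

Lemma integral_mix_hi :
  (\int[mu]_(u in D `&` hi) (a u)%:E = \int[mu]_(u in D `&` hi) (b u)%:E)%E.
Proof. by apply: integral_aE; [exact: measurable_hi|rewrite -!qE]. Qed.

Lemma integral_mix_lo :
  (\int[mu]_(u in D `&` lo) (a u)%:E = \int[mu]_(u in D `&` lo) (b u)%:E)%E.
Proof.
apply: integral_aE; first exact: measurable_lo.
by rewrite -!onem_qE q_mix mulrBr mulrBr mulr1 mulr1 addrACA subrKC opprD.
Qed.

Let mb : measurable_fun setT b. Proof. exact: mwt. Qed.
Let b_ge0 u : 0 <= b u. Proof. exact: wt_ge0. Qed.

Let b_fin A : measurable A -> (\int[mu]_(u in D `&` A) (b u)%:E < +oo)%E.
Proof. by move=> mA; rewrite integral_weight_ratio// ltry. Qed.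

(** If [g > c] on all of [A], then [a > b] on a set of positive mass, against the equality of the
    integrals. *)
Let strict A : measurable A -> (0 < mu (D `&` A))%E ->
  (\int[mu]_(u in D `&` A) (a u)%:E = \int[mu]_(u in D `&` A) (b u)%:E)%E ->
  exists2 u, A u & g u <= c.
Proof.
move=> mA A0 E; apply: contrapT => /forall2NP H.
suff : (\int[mu]_(u in D `&` A) (b u)%:E < \int[mu]_(u in D `&` A) (a u)%:E)%E.
  by rewrite E ltxx.
apply: integral_lt_pos.
- by apply: measurableI => //; exact: measurable_D.
- exact: A0.
- by apply: measurable_funTS; exact: measurable_mix.
- exact: measurable_funTS.
- move=> u _; exact: b_ge0.
- move=> u [_ Au]; rewrite ba ltNge; apply/negP.
  by case: (H u).
- exact: b_fin.
Qed.

(* If [g theta0] exceeded [c], then quasi-convexity would make [a > b] on a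
   whole side of [theta0], although both have the same integral there. *)
Let g_theta0 : (g theta0 <= c : Prop).
Proof.
have [u /= hu gu] := strict measurable_hi mu_hi_gt0 integral_mix_hi.
have [v /= lv gv] := strict measurable_lo mu_lo_gt0 integral_mix_lo.
move: lv; rewrite le_eqVlt => /orP[/eqP <-//|vt].
by apply: (@g_qc v theta0 u) => //; rewrite vt hu.
Qed.

(** The set [g <= c] is an interval containing [theta0]. Above [theta0] it is therefore an initial
    segment, and in [crossing_lo] it is a final one. *)
Let crossing_hi u v : theta0 < u -> theta0 < v -> a u <= b u -> b v < a v -> u < v.
Proof.
rewrite ab ba => tu tv gu gv; rewrite ltNge; apply/negP.
rewrite le_eqVlt => /orP[/eqP vu|vu]; first by move: gv; rewrite vu ltNge gu.
by move: gv; rewrite ltNge (@g_qc theta0 v u)// tv vu.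
Qed.

Let crossing_lo u v : u <= theta0 -> v <= theta0 -> a u <= b u -> b v < a v -> v < u.
Proof.
rewrite ab ba => tu tv gu gv; rewrite ltNge; apply/negP.
rewrite le_eqVlt => /orP[/eqP uv|uv]; first by move: gv; rewrite -uv ltNge gu.
move: tv; rewrite le_eqVlt => /orP[/eqP vt|vt].
  by move: gv; rewrite vt ltNge g_theta0.
by move: gv; rewrite ltNge (@g_qc u v theta0)// uv vt.
Qed.

(** On each side the mixed density exceeds the one at [y0] only far from [theta0], which is where
    [Phi1] is small above and [Phi0] is small below. Moving mass there lowers both integrals. *)
Lemma tangent_mean_mixture_le (Phi1 Phi0 : R -> R) :
  measurable_fun setT Phi1 -> measurable_fun setT Phi0 ->
  (forall u, D u -> 0 <= Phi1 u <= 1) -> (forall u, D u -> 0 <= Phi0 u <= 1) ->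
  (forall u v, D u -> D v -> u < v -> Phi1 v <= Phi1 u) ->
  (forall u v, D u -> D v -> u < v -> Phi0 u <= Phi0 v) ->
  (l%:E * tangent_mean n Phi1 Phi0 y1 + (1 - l)%:E * tangent_mean n Phi1 Phi0 y2 <=
   tangent_mean n Phi1 Phi0 y0)%E.
Proof.
move=> mP1 mP0 P1_01 P0_01 P1_le P0_le.
have mDh : measurable (D `&` hi) by apply: measurableI; [exact: measurable_D|exact: measurable_hi].
have mDl : measurable (D `&` lo) by apply: measurableI; [exact: measurable_D|exact: measurable_lo].
have J0 y A Phi : (forall u, D u -> 0 <= Phi u <= 1) ->
    (0 <= \int[mu]_(u in D `&` A) (Phi u * (weight n y u / tilted n y setT))%:E)%E.
  move=> P01; apply: integral_ge0 => u [Du _]; rewrite lee_fin.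
  by apply: mulr_ge0; [have /andP[] := P01 u Du|exact: wt_ge0].
rewrite /tangent_mean.
rewrite (ge0_muleDr _ (J0 y1 hi Phi1 P1_01) (J0 y1 lo Phi0 P0_01)).
rewrite (ge0_muleDr _ (J0 y2 hi Phi1 P1_01) (J0 y2 lo Phi0 P0_01)).
rewrite addeACA.
rewrite -(integral_mix mDh mP1); last by move=> u [/P1_01/andP[]].
rewrite -(integral_mix mDl mP0); last by move=> u [/P0_01/andP[]].
apply: leeD.
- apply: (@integral_le_of_crossing _ _ _ mu (D `&` hi) a b Phi1).
  + exact: mDh.
  + by apply: measurable_funTS; exact: measurable_mix.
  + by apply: measurable_funTS; exact: mb.
  + exact: measurable_funTS.
  + by move=> u _; exact: a_ge0.
  + by move=> u _; exact: b_ge0.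
  + by move=> u [/P1_01].
  + exact: integral_mix_hi.
  + by rewrite integral_mix_hi; apply: b_fin; exact: measurable_hi.
  + move=> u v [Du /= hu] [Dv /= hv] h1 h2.
    by apply: P1_le; [exact: Du|exact: Dv|exact: crossing_hi h1 h2].
- apply: (@integral_le_of_crossing _ _ _ mu (D `&` lo) a b Phi0).
  + exact: mDl.
  + by apply: measurable_funTS; exact: measurable_mix.
  + by apply: measurable_funTS; exact: mb.
  + exact: measurable_funTS.
  + by move=> u _; exact: a_ge0.
  + by move=> u _; exact: b_ge0.
  + by move=> u [/P0_01].
  + exact: integral_mix_lo.
  + by rewrite integral_mix_lo; apply: b_fin; exact: measurable_lo.
  + move=> u v [Du /= hu] [Dv /= hv] h1 h2.
    by apply: P0_le; [exact: Dv|exact: Du|exact: crossing_lo h1 h2].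
Qed.

End mixture.

Section tangent.
Variables (n : nat) (f t1 t0 : R -> R) (y0 : R).
Hypotheses (af : admissible f) (tl : supporting_lines f t1 t0).

(** The line is taken at the posterior probability reached from [y0] by observing [x], and stays
    attached to [x] when the state [y] varies. *)
Let phi1 x := t1 (qq n.+1 (y0 + x)).
Let phi0 x := t0 (qq n.+1 (y0 + x)).

Let q01' y : 0 < qq n.+1 y < 1. Proof. exact: q01. Qed.

Let phi_01 x : 0 <= phi1 x <= 1 /\ 0 <= phi0 x <= 1.
Proof. exact: supporting_lines01 tl af.1 (q01' (y0 + x)). Qed.

Lemma tangent_slope_mono x z : x <= z -> phi1 z <= phi1 x /\ phi0 x <= phi0 z.
Proof.
move=> xz; apply: (supporting_lines_mono tl (q01' (y0 + x)) (q01' (y0 + z))).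
by apply: q_le; rewrite lerD2l.
Qed.

Lemma measurable_tangent1 : measurable_fun setT phi1.
Proof. by apply: nonincreasing_measurable => // x z /tangent_slope_mono[]. Qed.

Lemma measurable_tangent0 : measurable_fun setT phi0.
Proof. by apply: nondecreasing_measurable => // x z /tangent_slope_mono[]. Qed.

Lemma tangent1_01 x : 0 <= phi1 x <= 1. Proof. exact: (phi_01 x).1. Qed.
Lemma tangent0_01 x : 0 <= phi0 x <= 1. Proof. exact: (phi_01 x).2. Qed.

Let J := tangent_mean n (param_mean phi1) (param_mean phi0).
Let rr y A x := tilted n.+1 (y + x) A / tilted n y setT.

Let mrr y A : measurable A -> measurable_fun setT (rr y A).
Proof.
move=> mA; apply: measurable_funM => //; apply: measurable_tilted => //.
exact: measurable_funD.
Qed.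

Let rr0 y A x : 0 <= rr y A x. Proof. by apply: divr_ge0; exact: tilted_ge0. Qed.

Let JE y : J y = (\int[nu]_x (phi1 x * rr y hi x + phi0 x * rr y lo x)%:E)%E.
Proof.
have h1 : (\int[nu]_x (phi1 x * rr y hi x)%:E = _)%E :=
  integral_tilted_mean measurable_tangent1 tangent1_01 n y measurable_hi.
have h0 : (\int[nu]_x (phi0 x * rr y lo x)%:E = _)%E :=
  integral_tilted_mean measurable_tangent0 tangent0_01 n y measurable_lo.
rewrite /J /tangent_mean -h1 -h0 -ge0_integralD//.
- move=> x _; rewrite lee_fin; apply: mulr_ge0; last exact: rr0.
  by have /andP[] := tangent1_01 x.
- apply/measurable_EFinP; apply: measurable_funM; first exact: measurable_tangent1.
  exact: mrr measurable_hi.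
- move=> x _; rewrite lee_fin; apply: mulr_ge0; last exact: rr0.
  by have /andP[] := tangent0_01 x.
- apply/measurable_EFinP; apply: measurable_funM; first exact: measurable_tangent0.
  exact: mrr measurable_lo.
Qed.

(** Since [q] is a ratio of masses at the next state, multiplying by [predictive] makes the value of
    the line linear in the upper and lower masses. *)
Let split_pred y x t s :
  (qq n.+1 (y + x) * t + (1 - qq n.+1 (y + x)) * s) * predictive n y x =
    t * rr y hi x + s * rr y lo x.
Proof.
rewrite /rr onem_qE qE /predictive.
have := @tilted_setT_gt0 R M n.+1 (y + x); have := @tilted_setT_gt0 R M n y.
set m := tilted n y setT; set m' := tilted _ _ setT.
set h := tilted _ _ hi; set k := tilted _ _ lo.
clearbody m m' h k => m0 m0'.
by field; rewrite (gt_eqF m0) (gt_eqF m0').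
Qed.

(** [J] is a majorant of [next_mean n f] that touches it at [y0], because each supporting line
    majorizes [f] and touches it at the point reached from [y0]. *)
Lemma next_mean_le_tangent y : ((next_mean n f y)%:E <= J y)%E.
Proof.
rewrite next_meanE// JE; apply: ge0_le_integral => //.
- move=> x _; rewrite lee_fin; apply: mulr_ge0.
    by have /andP[] := af.1 _ (q01' (y + x)).
  by apply: ltW; exact: predictive_gt0.
- apply/measurable_EFinP; apply: measurable_funM; last exact: mrr.
  by apply: measurable_admissible_q; [exact: af|exact: measurable_funD].
- apply/measurable_EFinP/measurable_funD; apply: measurable_funM.
  + exact: measurable_tangent1.
  + exact: mrr measurable_hi.
  + exact: measurable_tangent0.
  + exact: mrr measurable_lo.
- move=> x _; rewrite lee_fin -split_pred; apply: ler_wpM2r.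
    by apply: ltW; exact: predictive_gt0.
  exact: (tl (q01' (y0 + x)) (q01' (y + x))).2.
Qed.

Lemma next_mean_tangent : (next_mean n f y0)%:E = J y0.
Proof.
rewrite next_meanE// JE; apply: eq_integral => x _; congr EFin.
rewrite -split_pred; congr (_ * _).
exact: (tl (q01' (y0 + x)) (q01' (y0 + x))).1.
Qed.

End tangent.

(** Mix the majorant [J] belonging to [y0]: the mixture of [next_mean] at [y1] and [y2] is at most
    that of [J], which is at most [J y0], which equals [next_mean] at [y0]. *)
Lemma next_mean_concave n f : admissible f ->
  concave01 (fun p => next_mean n f (yy n p)).
Proof.
move=> af l p1 p2 l01 p1_01 p2_01; set p0 := l * p1 + _.
have p0_01 : 0 < p0 < 1.
  rewrite /p0; apply/andP; split; first by rewrite addr_gt0// mulr_gt0//; lra.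
  have : l * p1 < l * 1 by rewrite ltr_pM2l; lra.
  have : (1 - l) * p2 < (1 - l) * 1 by rewrite ltr_pM2l; lra.
  lra.
have q_mix : qq n (yy n p0) = l * qq n (yy n p1) + (1 - l) * qq n (yy n p2).
  by rewrite (q_yinv n p0_01) (q_yinv n p1_01) (q_yinv n p2_01).
move: (yy n p0) (yy n p1) (yy n p2) q_mix => y0 y1 y2 q_mix {p0 p0_01 p1_01 p2_01}.
have [t1 [t0 tl]] := supporting_linesP af.2.
have l0 : (0 <= l%:E)%E by rewrite lee_fin ltW//; have /andP[] := l01.
have l1 : (0 <= (1 - l)%:E)%E by rewrite lee_fin subr_ge0 ltW//; have /andP[] := l01.
have m1 := measurable_tangent1 n y0 tl; have m0 := measurable_tangent0 n y0 tl.
have b1 := tangent1_01 n y0 af tl; have b0 := tangent0_01 n y0 af tl.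
have := tangent_mean_mixture_le l01 q_mix
  (measurable_param_mean m1 b1) (measurable_param_mean m0 b0)
  (param_mean01 m1 b1) (param_mean01 m0 b0).
rewrite -(next_mean_tangent n y0 af tl) => H.
have {}H : (l%:E * (next_mean n f y1)%:E + (1 - l)%:E * (next_mean n f y2)%:E <=
    (next_mean n f y0)%:E)%E.
  apply: (le_trans _ (H _ _)).
  - by apply: leeD; apply: lee_wpmul2l; [exact: l0|exact: next_mean_le_tangent
      |exact: l1|exact: next_mean_le_tangent].
  - move=> u v Du Dv uv; apply: (param_mean_le m1 b1 Du Dv) => x z.
    rewrite ltr_pM2l ?subr_gt0; [move/ltW => xz|exact: uv].
    exact: (tangent_slope_mono n y0 tl xz).1.
  - move=> u v Du Dv uv; apply: (param_mean_le m0 b0 Dv Du) => x z.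
    rewrite ltr_nM2l ?subr_lt0; [move/ltW => xz|exact: uv].
    exact: (tangent_slope_mono n y0 tl xz).2.
by move: H; rewrite -!EFinM -EFinD lee_fin.
Qed.

End concavity.

(** * Conditional laws of the observations *)

Section conditional_laws.
Context {R : realType} {M : bayes_model R}.
Local Notation nu := (obs_measure M).
Local Notation mu := (prior M).
Local Notation theta0 := (threshold M).
Local Notation D := (interior (natural_parameters nu)).
Local Notation qq := (q nu mu theta0).
Local Notation yy := (yinv nu mu theta0).
Local Notation weight := (weight M).
Local Notation tilted := (tilted M).
Local Notation predictive := (predictive M).
Local Notation next_mean := (next_mean M).

Context {d : measure_display} {Omega : measurableType d}.
Variables (Theta : {mfun Omega >-> R}) (X : nat -> {mfun Omega >-> R}).
Variable P : nat -> R -> probability Omega R.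
Hypothesis modelP : sampling_model nu mu theta0 Theta X P.
Variables (n : nat) (p : R).
Hypothesis p01 : 0 < p < 1.

Local Notation Q := (P n p).
Local Notation y := (yy n p).
Local Notation F := (filtration X n).

Definition obs_sum (k : nat) (w : Omega) : R := \sum_(i < k) X (n + i).+1 w.

Definition cylinder (k : nat) (B : nat -> set R) : set Omega :=
  \bigcap_(i in `I_k) (X (n + i).+1 @^-1` B i).

Definition cylinders (k : nat) : set (set Omega) :=
  [set A | exists2 B : nat -> set R, (forall i, measurable (B i)) & A = cylinder k B].

Lemma measurable_cylinder k B : (forall i, measurable (B i)) -> measurable (cylinder k B).
Proof.
by move=> mB; apply: bigcap_measurableType => i _; exact: measurable_funPTI.
Qed.

Lemma cylindersI k : setI_closed (cylinders k).
Proof.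
move=> _ _ [B mB ->] [B' mB' ->]; exists (fun i => B i `&` B' i).
  by move=> i; exact: measurableI.
by rewrite /cylinder -bigcapI.
Qed.

Lemma cylinders_setT k : cylinders k setT.
Proof.
exists (fun=> setT) => //; rewrite /cylinder; apply/seteqP; split => // w _ i _.
Qed.

Lemma cylinderS k B : cylinder k.+1 B = cylinder k B `&` (X (n + k).+1 @^-1` B k).
Proof.
rewrite /cylinder IIS bigcap_setU bigcap_set1.
by [].
Qed.

Lemma filtration_measurable k : F k `<=` measurable.
Proof.
apply: smallest_sub; first exact: sigma_algebra_measurable.
by move=> _ [i [B [_ mB ->]]]; exact: measurable_funPTI.
Qed.

Lemma filtration_sub j k : (j <= k)%N -> F j `<=` F k.
Proof.
move=> jk; apply: sub_smallest2r; first exact: smallest_sigma_algebra.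
move=> _ [i [B [ij mB ->]]]; exists i, B; split => //.
exact: leq_trans jk.
Qed.

Lemma filtration_sub_cylinders k : F k `<=` <<s cylinders k >>.
Proof.
apply: sub_smallest2r; first exact: smallest_sigma_algebra.
move=> _ [i [B [ik mB ->]]].
exists (fun j => if j == i then B else setT); first by move=> j; case: ifP.
apply/seteqP; split => w /=; first by move=> Bw j /= _; case: eqP => // ->.
by move=> /(_ i ik); rewrite eqxx.
Qed.

Lemma filtration_obs k i B : (i < k)%N -> measurable B -> F k (X (n + i).+1 @^-1` B).
Proof. by move=> ik mB; apply: sub_gen_smallest; exists i, B. Qed.

Lemma filtration_cylinder k (B : nat -> set R) : (forall i, measurable (B i)) ->
  F k (cylinder k B).
Proof.
move=> mB; apply: (@bigcap_measurableType _ (g_sigma_algebraType _)) => i ik.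
exact: filtration_obs.
Qed.

Lemma filtration_obs_sum k B : measurable B -> F k (obs_sum k @^-1` B).
Proof.
pose G := [set E | exists i (B : set R),
  [/\ (i < k)%N, measurable B & E = X (n + i).+1 @^-1` B]].
have mS : measurable_fun setT (obs_sum k : g_sigma_algebraType G -> R).
  rewrite /obs_sum; apply: measurable_sum => i _ C mC.
  by rewrite setTI; apply: sub_gen_smallest; exists i, C; split.
by move=> mB; have := mS measurableT B mB; rewrite setTI.
Qed.

Lemma filtrationI k A B : F k A -> F k B -> F k (A `&` B).
Proof.
by move=> FA FB; exact: (@measurableI _ (g_sigma_algebraType _) A B FA FB).
Qed.

Lemma filtrationT k : F k setT.
Proof. exact: (@measurableT _ (g_sigma_algebraType _)). Qed.

Lemma measurable_obs_sum k : measurable_fun setT (obs_sum k).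
Proof. by apply: measurable_sum => i _; exact: measurable_funPT. Qed.

(** A criterion for [f] to integrate like the conditional probability of [E] given [F k]. Both sides
    are measures in [A], the left one finite, so the generating pi-system of cylinders suffices. *)
Lemma filtration_density k (E : set Omega) (f : Omega -> \bar R) :
  measurable E -> measurable_fun setT f -> (forall w, 0 <= f w)%E ->
  (forall B, (forall i, measurable (B i)) ->
    Q (cylinder k B `&` E) = (\int[Q]_(w in cylinder k B) f w)%E) ->
  forall A, F k A -> Q (A `&` E) = (\int[Q]_(w in A) f w)%E.
Proof.
move=> mE mf f0 cyl A /filtration_sub_cylinders FA.
have [m mP] := density_measure_exists Q mf f0.
rewrite -mP; apply: (@eq_measure_g_sigma _ _ _ (cylinders k) (mrestr Q mE) m) => //.
- by move=> _ [B mB ->]; exact: measurable_cylinder.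
- exact: cylindersI.
- exact: cylinders_setT.
- by apply: le_lt_trans (probability_le1 _ _) _; rewrite ?ltry// setTI.
- by move=> _ [B mB ->]; rewrite mP -cyl.
Qed.

Lemma posteriorE A : measurable A ->
  Q (Theta @^-1` A) = (tilted n y A / tilted n y setT)%:E.
Proof.
move=> mA; rewrite (modelP n p01).1// /posterior /tilted.
rewrite mass_setI//; congr (_ / fine _)%:E.
by rewrite -[in LHS](setIT (msupport mu)) mass_setI.
Qed.

Lemma Theta_D : Q (~` (Theta @^-1` D)) = 0%E.
Proof.
rewrite preimage_setC posteriorE; last by apply: measurableC; exact: measurable_D.
by rewrite /tilted setICr /mass integral_set0/= mul0r.
Qed.

(** Real-valued version of [obs_law]. They agree for measurable sets and parameters in [D], where
    [Theta] lies almost surely. *)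
Definition obs_prob (u : R) (B : set R) : R := fine (obs_law nu u B).

Lemma indic01 (B : set R) x : 0 <= (\1_B x : R) <= 1.
Proof. by rewrite indicE; case: (_ \in _); rewrite /= ?lexx ler01. Qed.

Lemma obs_law_ge0 u B : (0 <= obs_law nu u B)%E.
Proof. by apply: integral_ge0 => x _; rewrite lee_fin ltW// density_gt0. Qed.

Lemma obs_lawE u B : obs_law nu u B = (\int[nu]_x (\1_B x * density nu u x)%:E)%E.
Proof.
rewrite /obs_law integral_setE; apply: eq_integral => x _.
by rewrite -EFinM mulrC.
Qed.

Lemma obs_probE u B : measurable B -> D u -> (obs_prob u B)%:E = obs_law nu u B.
Proof.
move=> mB Du; rewrite obs_lawE /obs_prob obs_lawE.
have mb : measurable_fun setT (\1_B : R -> R) by exact: measurable_indic.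
by have := param_meanE mb (indic01 B) Du.
Qed.

Lemma obs_prob_ge0 u B : 0 <= obs_prob u B.
Proof. by apply: fine_ge0; exact: obs_law_ge0. Qed.

Lemma measurable_obs_prob B : measurable B -> measurable_fun setT (obs_prob ^~ B).
Proof.
move=> mB; rewrite (_ : obs_prob ^~ B = param_mean M \1_B).
  by apply: measurable_param_mean; [exact: measurable_indic|exact: indic01].
by apply/funext => u; rewrite /obs_prob obs_lawE.
Qed.

Lemma cylinder_Theta k (B : nat -> set R) C : (forall i, measurable (B i)) -> measurable C ->
  Q (Theta @^-1` C `&` cylinder k B) =
  (\int[Q]_(w in Theta @^-1` C) (\prod_(i < k) obs_prob (Theta w) (B i))%:E)%E.
Proof.
move=> mB mC.
have mTh E : measurable E -> measurable (Theta @^-1` E) by move=> mE; exact: measurable_funPTI.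
have mCD : measurable (C `&` D) by apply: measurableI => //; exact: measurable_D.
have mprod : measurable_fun setT (fun w => (\prod_(i < k) obs_prob (Theta w) (B i))%:E).
  apply/measurable_EFinP; apply: measurable_prod => i _.
  exact: (measurableT_comp (measurable_obs_prob (mB i))).
have prod0 w : (0 <= (\prod_(i < k) obs_prob (Theta w) (B i))%:E)%E.
  by rewrite lee_fin prodr_ge0// => i _; exact: obs_prob_ge0.
rewrite (ge0_integral_null_setC (E := Theta @^-1` D))//; last 4 first.
- exact: mTh.
- by apply: mTh; exact: measurable_D.
- exact: Theta_D.
- exact: measurable_funTS.
rewrite -preimage_setI.
have -> : Q (Theta @^-1` C `&` cylinder k B) =
    Q (Theta @^-1` (C `&` D) `&` cylinder k B).
  rewrite (probability_null_setC (mTh _ measurable_D) Theta_D).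
    by rewrite preimage_setI setIAC.
  by apply: measurableI; [exact: mTh|exact: measurable_cylinder].
rewrite (modelP n p01).2//; apply: eq_integral => w /set_mem[_ Dw].
rewrite -prodEFin; apply: eq_bigr => i _.
by rewrite obs_probE.
Qed.

(** [cylinder_Theta] is the case of an indicator. Both sides are integrals of [h] against images
    under [Theta] of measures with a density with respect to [Q]. *)
Lemma cylinder_Theta_integral k (B : nat -> set R) (h : R -> \bar R) :
  (forall i, measurable (B i)) -> measurable_fun setT h -> (forall u, 0 <= h u)%E ->
  (\int[Q]_(w in cylinder k B) h (Theta w) =
   \int[Q]_w (h (Theta w) * (\prod_(i < k) obs_prob (Theta w) (B i))%:E))%E.
Proof.
move=> mB mh h0.
pose f w := \prod_(i < k) obs_prob (Theta w) (B i).
have mf : measurable_fun setT f.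
  apply: measurable_prod => i _.
  exact: (measurableT_comp (measurable_obs_prob (mB i))).
have f0 w : 0 <= f w by apply: prodr_ge0 => i _; exact: obs_prob_ge0.
have [m mE] := density_measure_exists Q ((measurable_EFinP _ _).2 mf) (fun w => f0 w : (0 <= (f w)%:E)%E).
have mc := measurable_cylinder k mB.
have m1 : measurable_fun setT (EFin \o \1_(cylinder k B) : Omega -> \bar R).
  by apply/measurable_EFinP; exact: measurable_indic.
have [mc' mcE] := density_measure_exists Q m1 (fun w => ler0n _ _).
have mTh := measurable_funPT Theta.
pose l1' : {measure set _ -> \bar R} := pushforward mc' Theta.
pose l2' : {measure set _ -> \bar R} := pushforward m Theta.
pose l1 := l1' mTh; pose l2 := l2' mTh.
have l12 C : measurable C -> l1 C = l2 C.
  move=> mC; have mTC : measurable (Theta @^-1` C) by exact: measurable_funPTI.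
  rewrite /l1 /l2 /= /pushforward mcE mE integral_indic//.
  by rewrite -(cylinder_Theta k mB mC) setIC.
have hTh : measurable_fun setT (h \o Theta) by exact: measurableT_comp.
transitivity (\int[l1]_u h u)%E.
  rewrite ge0_integral_pushforward// preimage_setT.
  rewrite (@density_integral _ _ _ Q mc' (\1_(cylinder k B)))//.
  - by rewrite [LHS]integral_setE.
  - by move=> w; exact: h0.
transitivity (\int[l2]_u h u)%E.
  by apply: eq_measure_integral => E mE' _; exact: l12.
rewrite ge0_integral_pushforward// preimage_setT.
rewrite (@density_integral _ _ _ Q m f)//.
by move=> w; exact: h0.
Qed.

Lemma obs_prob_param_mean B : obs_prob ^~ B = param_mean M \1_B.
Proof. by apply/funext => u; rewrite /obs_prob obs_lawE. Qed.

Lemma measurable_tilted_setTV {d'} {T : measurableType d'} m (f : T -> R) :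
  measurable_fun setT f -> measurable_fun setT (fun t => (tilted m (f t) setT)^-1).
Proof.
move=> mf.
have -> : (fun t => (tilted m (f t) setT)^-1) =
    (fun t => expR (- ln (tilted m (f t) setT))).
  apply/funext => t; rewrite expRN lnK//.
  by rewrite posrE; exact: tilted_setT_gt0.
apply: measurableT_comp; first exact: measurable_expR.
apply: measurableT_comp => //; apply: measurableT_comp; first exact: measurable_ln.
exact: measurable_tilted.
Qed.

Definition ratio (m : nat) (s : R) (C : set R) : R := tilted m s C / tilted m s setT.

(** Density with respect to the prior of the posterior after observations with sum [z.1], at the
    parameter [z.2]. *)
Definition post_density (m : nat) (z : R * R) : R :=
  \1_D z.2 * (weight m (y + z.1) z.2 / tilted m (y + z.1) setT).

Lemma measurable_ratio {d'} {T : measurableType d'} m (f : T -> R) C :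
  measurable C -> measurable_fun setT f -> measurable_fun setT (fun t => ratio m (f t) C).
Proof.
move=> mC mf; apply: measurable_funM; first exact: measurable_tilted.
exact: measurable_tilted_setTV.
Qed.

Lemma ratio_ge0 m s C : 0 <= ratio m s C.
Proof. by apply: divr_ge0; exact: tilted_ge0. Qed.

Lemma measurable_post_density m : measurable_fun setT (post_density m).
Proof.
have my : measurable_fun setT (fun z : R * R => y + z.1).
  by apply: measurable_funD; [exact: measurable_cst|exact: measurable_fst].
apply: measurable_funM.
  apply: measurableT_comp; last exact: measurable_snd.
  by apply: measurable_indic; exact: measurable_D.
apply: measurable_funM; first by apply: measurable_weight; [exact: my|exact: measurable_snd].
exact: measurable_tilted_setTV my.
Qed.

Lemma post_density_ge0 m z : 0 <= post_density m z.
Proof.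
apply: mulr_ge0; first exact: ler0n.
by apply: divr_ge0; [apply: ltW; exact: weight_gt0|exact: tilted_ge0].
Qed.

Lemma integral_post_density m s C : measurable C ->
  (\int[mu]_(u in C) (post_density m (s, u))%:E = (ratio m (y + s) C)%:E)%E.
Proof.
move=> mC; rewrite -(integral_weight_ratio m (y + s) mC).
rewrite [LHS]integral_setE [RHS]integral_setE; apply: eq_integral => u _.
by rewrite -!EFinM; congr EFin; rewrite /post_density indicI/=; ring.
Qed.

(** Bayes' formula at time [k]: given the first [k] observations, [Theta] has the prior tilted by
    the state [(n + k, y + obs_sum k)]. It is a predicate because the induction alternates it with
    the predictive law. *)
Definition posterior_at (k : nat) : Prop := forall A C, F k A -> measurable C ->
  (Q (A `&` Theta @^-1` C) =
   \int[Q]_(w in A) (ratio (n + k) (y + obs_sum k w) C)%:E)%E.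

Lemma posterior_at_integral k A (h : R * R -> \bar R) : posterior_at k -> F k A ->
  measurable_fun setT h -> (forall z, 0 <= h z)%E ->
  (\int[Q]_(w in A) h (obs_sum k w, Theta w) =
   \int[Q]_(w in A) \int[mu]_u
     (h (obs_sum k w, u) * (post_density (n + k) (obs_sum k w, u))%:E))%E.
Proof.
move=> postk FA mh h0.
apply: (@joint_density_integral _ _ _ _ _ _ _ Q mu A (obs_sum k) Theta
  (post_density (n + k))) => //.
- exact: measurable_obs_sum.
- exact: filtration_measurable FA.
- exact: measurable_post_density.
- exact: post_density_ge0.
- move=> B C mB mC; rewrite postk//.
    by apply: eq_integral => w _; rewrite integral_post_density.
  by apply: filtrationI => //; exact: filtration_obs_sum.
Qed.

(** Given [Theta], observation [k + 1] contributes the factor [obs_prob Theta (B k)]. This factor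
    becomes part of the integrand over the shorter cylinder; there [Theta] is integrated out by the
    posterior at time [k], and Tonelli's theorem restores the integral over the observation. *)
Lemma cylinder_posterior k (B : nat -> set R) C : posterior_at k ->
  (forall i, measurable (B i)) -> measurable C ->
  (Q (cylinder k.+1 B `&` Theta @^-1` C) =
   \int[Q]_(w in cylinder k B) \int[nu]_(x in B k)
     (tilted (n + k).+1 (y + obs_sum k w + x) C /
      tilted (n + k) (y + obs_sum k w) setT)%:E)%E.
Proof.
move=> postk mB mC.
pose h u : \bar R := (\1_C u * obs_prob u (B k))%:E.
have mh : measurable_fun setT h.
  apply/measurable_EFinP; apply: measurable_funM; first exact: measurable_indic.
  exact: measurable_obs_prob.
have h0 u : (0 <= h u)%E.
  by rewrite lee_fin; apply: mulr_ge0; [exact: ler0n|exact: obs_prob_ge0].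
have FB : F k (cylinder k B) := filtration_cylinder mB.
rewrite setIC cylinder_Theta// integral_setE.
transitivity (\int[Q]_w (h (Theta w) * (\prod_(i < k) obs_prob (Theta w) (B i))%:E))%E.
  apply: eq_integral => w _; rewrite -!EFinM; congr EFin.
  by rewrite big_ord_recr/= indicE/=; ring.
rewrite -cylinder_Theta_integral//.
have H := posterior_at_integral postk FB (measurableT_comp mh measurable_snd)
  (fun z => h0 z.2).
rewrite [LHS]H {H}.
apply: eq_integral => w _; set s := obs_sum k w.
have mb : measurable_fun setT (\1_(B k) : R -> R) by exact: measurable_indic.
have E := @integral_tilted_mean R M _ mb (indic01 (B k)) (n + k) (y + s) C mC.
rewrite [RHS]integral_setE in E.
transitivity (\int[nu]_x (\1_(B k) x * (tilted (n + k).+1 (y + s + x) C / tilted (n + k) (y + s) setT))%:E)%E.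
  rewrite [RHS]E; apply: eq_integral => u _; rewrite /h -!EFinM; congr EFin.
  have -> : obs_prob u (B k) = param_mean M \1_(B k) u.
    by rewrite -obs_prob_param_mean.
  by rewrite /post_density indicI/=; ring.
by rewrite [RHS]integral_setE; apply: eq_integral => x _; rewrite -EFinM mulrC.
Qed.

Lemma measurable_integral_section {d'} {T : measurableType d'} (f : T -> R) (B : set R)
    (g : R * R -> R) : measurable_fun setT f -> measurable B -> measurable_fun setT g ->
  (forall z, 0 <= g z) ->
  measurable_fun setT (fun t => \int[nu]_(x in B) (g (f t, x))%:E)%E.
Proof.
move=> mf mB mg g0.
pose g' (z : R * R) := (g z * \1_B z.2)%:E.
rewrite (_ : (fun t => _) = fubini_F nu g' \o f); last first.
  by apply/funext => t; rewrite integral_setE.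
apply: measurableT_comp => //; apply: measurable_fun_fubini_tonelli_F.
- apply/measurable_EFinP; apply: measurable_funM => //.
  by apply: measurableT_comp; [exact: measurable_indic|exact: measurable_snd].
- by move=> z; rewrite lee_fin; apply: mulr_ge0; [exact: g0|exact: ler0n].
Qed.

Definition pred_density (m : nat) (z : R * R) : R := predictive m (y + z.1) z.2.

Lemma measurable_pred_density m : measurable_fun setT (pred_density m).
Proof.
have my : measurable_fun setT (fun z : R * R => y + z.1).
  by apply: measurable_funD; [exact: measurable_cst|exact: measurable_fst].
apply: measurable_funM; last exact: measurable_tilted_setTV my.
by apply: measurable_tilted => //; apply: measurable_funD => //; exact: measurable_snd.
Qed.

Lemma predictive_at k A B : posterior_at k -> F k A -> measurable B ->
  (Q (A `&` X (n + k).+1 @^-1` B) =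
   \int[Q]_(w in A) \int[nu]_(x in B) (pred_density (n + k) (obs_sum k w, x))%:E)%E.
Proof.
move=> postk FA mB; move: A FA; apply: filtration_density.
- exact: measurable_funPTI.
- apply: measurable_integral_section => //.
  + exact: measurable_obs_sum.
  + exact: measurable_pred_density.
  + by move=> z; apply: ltW; exact: predictive_gt0.
- move=> w; apply: integral_ge0 => x _; rewrite lee_fin.
  by apply: ltW; exact: predictive_gt0.
(* Prescribing [B] in position [k] makes the intersection a cylinder of length [k + 1], to which
   [cylinder_posterior] applies with [C = setT]. *)
move=> B' mB'; pose B'' i := if (i < k)%N then B' i else B.
have mB'' i : measurable (B'' i) by rewrite /B''; case: ifP.
have cB : cylinder k B' = cylinder k B''.
  by apply: eq_bigcapr => i /= ik; rewrite /B'' ik.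
have kB : B'' k = B by rewrite /B'' ltnn.
rewrite cB -[in LHS]kB -cylinderS -[X in Q X]setIT -(preimage_setT Theta).
have H := cylinder_posterior postk mB'' measurableT.
by rewrite [LHS]H kB; apply: eq_integral => w _; exact: eq_integral.
Qed.

Lemma predictive_integral k A (h : R * R -> \bar R) : posterior_at k -> F k A ->
  measurable_fun setT h -> (forall z, 0 <= h z)%E ->
  (\int[Q]_(w in A) h (obs_sum k w, X (n + k).+1 w) =
   \int[Q]_(w in A) \int[nu]_x
     (h (obs_sum k w, x) * (pred_density (n + k) (obs_sum k w, x))%:E))%E.
Proof.
move=> postk FA mh h0.
apply: (@joint_density_integral _ _ _ _ _ _ _ Q nu A (obs_sum k) (X (n + k).+1)
  (pred_density (n + k))) => //.
- exact: measurable_obs_sum.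
- exact: filtration_measurable FA.
- exact: measurable_pred_density.
- by move=> z; apply: ltW; exact: predictive_gt0.
- move=> B C mB mC; rewrite predictive_at//.
  by apply: filtrationI => //; exact: filtration_obs_sum.
Qed.

Lemma obs_sumS k w : obs_sum k.+1 w = obs_sum k w + X (n + k).+1 w.
Proof. by rewrite /obs_sum big_ord_recr. Qed.

(** The posterior at [k] yields the predictive law of the next observation. In [cylinder_posterior],
    the integrand is the new posterior ratio times that predictive density, so integrating over the
    observation gives the formula at [k + 1]. *)
Lemma posterior_at_all k : posterior_at k.
Proof.
elim: k => [|k IHk] A C FA mC; move: A FA; apply: filtration_density.
- exact: measurable_funPTI.
- apply/measurable_EFinP; apply: measurable_ratio => //.
  by apply: measurable_funD => //; exact: measurable_obs_sum.
- by move=> w; rewrite lee_fin ratio_ge0.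
- move=> B mB.
  have -> : cylinder 0 B = setT by apply/seteqP; split.
  rewrite setTI posteriorE//.
  under eq_integral do rewrite /obs_sum big_ord0 addr0 addn0.
  rewrite integral_cst// [X in (_ * X)%E](_ : _ = 1%E) ?mule1//.
  exact: probability_setT.
- exact: measurable_funPTI.
- apply/measurable_EFinP; apply: measurable_ratio => //.
  by apply: measurable_funD => //; exact: measurable_obs_sum.
- by move=> w; rewrite lee_fin ratio_ge0.
- move=> B mB; rewrite cylinder_posterior// cylinderS integral_mkcondr.
  pose h (z : R * R) : \bar R :=
    (\1_(B k) z.2 * ratio (n + k.+1) (y + (z.1 + z.2)) C)%:E.
  have mh : measurable_fun setT h.
    apply/measurable_EFinP; apply: measurable_funM.
      by apply: measurableT_comp; [exact: measurable_indic|exact: measurable_snd].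
    apply: measurable_ratio => //; apply: measurable_funD; first exact: measurable_cst.
    by apply: measurable_funD; [exact: measurable_fst|exact: measurable_snd].
  have h0 z : (0 <= h z)%E.
    by rewrite lee_fin; apply: mulr_ge0; [exact: ler0n|exact: ratio_ge0].
  have H := predictive_integral IHk (filtration_cylinder mB) mh h0.
  transitivity (\int[Q]_(w in cylinder k B) h (obs_sum k w, X (n + k).+1 w))%E.
    rewrite [RHS]H; apply: eq_integral => w _.
    rewrite [LHS]integral_setE; apply: eq_integral => x _.
    rewrite -!EFinM; congr EFin.
    rewrite /h /pred_density /predictive /ratio/= addnS addrA.
    have m0_neq0 : tilted (n + k) (y + obs_sum k w) setT != 0.
      by rewrite gt_eqF// tilted_setT_gt0.
    have m1_neq0 : tilted (n + k).+1 (y + obs_sum k w + x) setT != 0.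
      by rewrite gt_eqF// tilted_setT_gt0.
    move: m0_neq0 m1_neq0; set m0 := tilted _ _ setT; set m1 := tilted _ _ setT.
    set a := tilted _ _ C; set i := \1_(B k) x.
    by clearbody m0 m1 a i => m0_neq0 m1_neq0; field; rewrite m0_neq0.
  apply: eq_integral => w _; rewrite patchE /h/= -obs_sumS indicE.
  have -> : (w \in X (n + k).+1 @^-1` B k) = (X (n + k).+1 w \in B k).
    by apply/idP/idP; rewrite !inE.
  by case: ifP => _; rewrite ?mul1r ?mul0r.
Qed.

(** Markov property: the conditional mean of [f] at the next posterior probability depends on the
    past only through the current state. *)
Lemma next_mean_conditional k A f : F k A -> admissible f ->
  (\int[Q]_(w in A) (f (qq (n + k.+1) (y + obs_sum k.+1 w)))%:E =
   \int[Q]_(w in A) (next_mean (n + k) f (y + obs_sum k w))%:E)%E.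
Proof.
move=> FA af.
pose h (z : R * R) : \bar R := (f (qq (n + k.+1) (y + (z.1 + z.2))))%:E.
have mh : measurable_fun setT h.
  apply/measurable_EFinP; apply: measurable_admissible_q => //.
  apply: measurable_funD; first exact: measurable_cst.
  by apply: measurable_funD; [exact: measurable_fst|exact: measurable_snd].
have h0 z : (0 <= h z)%E.
  by rewrite lee_fin; have /andP[] := af.1 _ (@q01 R M (n + k.+1) (y + (z.1 + z.2))).
transitivity (\int[Q]_(w in A) h (obs_sum k w, X (n + k).+1 w))%E.
  by apply: eq_integral => w _; rewrite obs_sumS.
have H := predictive_integral (@posterior_at_all k) FA mh h0.
rewrite [LHS]H {H}; apply: eq_integral => w _.
rewrite [RHS]next_meanE; last exact: af.
by apply: eq_integral => x _; rewrite -EFinM /h/= addnS addrA.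
Qed.

End conditional_laws.

(** * Optimal stopping *)

Section truncated_value.
Context {R : realType} {M : bayes_model R}.
Local Notation nu := (obs_measure M).
Local Notation mu := (prior M).
Local Notation theta0 := (threshold M).
Local Notation qq := (q nu mu theta0).
Local Notation yy := (yinv nu mu theta0).
Local Notation predictive := (predictive M).
Local Notation next_mean := (next_mean M).

Variable c : R.
Hypothesis c_ge0 : 0 <= c.

(* Value of the problem with at most [N] further observations. *)
Fixpoint vtrunc (N n : nat) (p : R) : R :=
  if 0 < p < 1 then
    if N is N'.+1 then
      Num.min (Num.min p (1 - p)) (c + next_mean n (vtrunc N' n.+1) (yy n p))
    else Num.min p (1 - p)
  else 0.

Lemma vtruncS N n p : 0 < p < 1 -> vtrunc N.+1 n p =
  Num.min (Num.min p (1 - p)) (c + next_mean n (vtrunc N n.+1) (yy n p)).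
Proof. by move=> /= ->. Qed.

Lemma vtrunc0 n p : 0 < p < 1 -> vtrunc 0 n p = Num.min p (1 - p).
Proof. by move=> /= ->. Qed.

Lemma vtrunc_out N n p : ~~ (0 < p < 1) -> vtrunc N n p = 0.
Proof. by case: N => [|N] /= /negbTE->. Qed.

Lemma eq_concave01 (f g : R -> R) : (forall p, 0 < p < 1 -> f p = g p) ->
  concave01 f -> concave01 g.
Proof.
move=> fg cf l p1 p2 l01 p1_01 p2_01.
have p_01 : 0 < l * p1 + (1 - l) * p2 < 1 by apply/andP; split; nra.
by rewrite -!fg//; exact: cf.
Qed.

Lemma concave01_min (f g : R -> R) : concave01 f -> concave01 g ->
  concave01 (fun p => Num.min (f p) (g p)).
Proof.
move=> cf cg l p1 p2 l01 p1_01 p2_01; rewrite le_min; apply/andP; split.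
  apply: le_trans (cf l p1 p2 l01 p1_01 p2_01).
  by apply: lerD; apply: ler_wpM2l; rewrite ?ge_min ?lexx//; lra.
apply: le_trans (cg l p1 p2 l01 p1_01 p2_01).
by apply: lerD; apply: ler_wpM2l; rewrite ?ge_min ?lexx ?orbT//; lra.
Qed.

Lemma concave01_addl (a : R) (f : R -> R) : concave01 f -> concave01 (fun p => a + f p).
Proof.
by move=> cf l p1 p2 l01 p1_01 p2_01; have := cf l p1 p2 l01 p1_01 p2_01; lra.
Qed.

Lemma concave01_cost : concave01 (fun p : R => Num.min p (1 - p)).
Proof. by apply: concave01_min => l p1 p2 _ _ _; lra. Qed.

Lemma next_mean_ge0 n f s : admissible f -> 0 <= next_mean n f s.
Proof.
move=> af; apply: fine_ge0; apply: integral_ge0 => x _; rewrite lee_fin.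
apply: mulr_ge0; last by apply: ltW; exact: predictive_gt0.
by have /andP[] := af.1 _ (@q01 R M n.+1 (s + x)).
Qed.

Lemma vtrunc_admissible N n : admissible (vtrunc N n).
Proof.
elim: N n => [|N IHN] n; split.
- by move=> p p01; rewrite vtrunc0// lexx andbT le_min; lra.
- by apply: eq_concave01 concave01_cost => p p01; rewrite vtrunc0.
- move=> p p01; rewrite vtruncS// ge_min lexx/= andbT le_min.
  apply/andP; split; first by rewrite le_min; lra.
  by apply: addr_ge0 => //; exact: next_mean_ge0.
- have cS : concave01 (fun p => c + next_mean n (vtrunc N n.+1) (yy n p)).
    by apply: concave01_addl; apply: next_mean_concave; exact: IHN.
  by apply: eq_concave01 (concave01_min concave01_cost cS) => p p01; rewrite vtruncS.
Qed.

Lemma next_mean_le n f g s : admissible f -> admissible g ->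
  (forall p, 0 < p < 1 -> f p <= g p) -> next_mean n f s <= next_mean n g s.
Proof.
move=> af ag fg; rewrite -lee_fin [leLHS]next_meanE; last exact: af.
rewrite [leRHS]next_meanE; last exact: ag.
have m f' : admissible f' ->
    measurable_fun setT (fun x => (f' (qq n.+1 (s + x)) * predictive n s x)%:E).
  move=> af'; apply/measurable_EFinP; apply: measurable_funM.
    by apply: measurable_admissible_q => //; exact: measurable_funD.
  apply: measurable_funM => //; apply: measurable_tilted => //.
  exact: measurable_funD.
have p0 f' x : admissible f' -> 0 <= f' (qq n.+1 (s + x)) * predictive n s x.
  move=> af'; apply: mulr_ge0; last by apply: ltW; exact: predictive_gt0.
  by have /andP[] := af'.1 _ (@q01 R M n.+1 (s + x)).
apply: ge0_le_integral => //.
- by move=> x _; rewrite lee_fin; exact: p0.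
- exact: m.
- exact: m.
- move=> x _; rewrite lee_fin; apply: ler_wpM2r.
    by apply: ltW; exact: predictive_gt0.
  by apply: fg; exact: q01.
Qed.

(* A nonnegative function that vanishes at 0 and 1 lies below its supporting
   lines also at 0 and 1. *)
Lemma admissible_convexN f : admissible f -> f 0 = 0 -> f 1 = 0 ->
  convex_function (`[0, 1]%classic : set R) (fun p => - f p).
Proof.
move=> af f0 f1 t x z; rewrite !inE/= !in_itv/= => x01 z01.
have t01 : 0 <= (t%:num : R) <= 1 by apply/andP; split.
change (- f ((t%:num : R) * (x : R) + (1 - (t%:num : R)) * (z : R)) <=
  (t%:num : R) * - f x + (1 - (t%:num : R)) * - f z).
move: (t%:num : R) (x : R) (z : R) t01 x01 z01 => {t x z} l x z.
move=> /andP[t0 t1] /andP[x0 x1] /andP[z0 z1].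
suff : l * f x + (1 - l) * f z <= f (l * x + (1 - l) * z) by lra.
have fpos r : 0 <= r <= 1 -> 0 <= f r.
  move=> /andP[r0 r1]; move: r0; rewrite le_eqVlt => /orP[/eqP<-|r0]; first by rewrite f0.
  move: r1; rewrite le_eqVlt => /orP[/eqP->|r1]; first by rewrite f1.
  by have /andP[] := af.1 r (introT andP (conj r0 r1)).
set q := l * x + (1 - l) * z.
have q0 : 0 <= q by rewrite /q; nra.
have q1 : q <= 1 by rewrite /q; nra.
(* If the mixture is an endpoint, every point of positive weight is that endpoint, where [f]
   vanishes. *)
have corner r (k : R) : 0 <= r <= 1 -> 0 <= k -> k * r = 0 \/ k * (1 - r) = 0 -> k * f r = 0.
  move=> r01 k0 [/eqP|/eqP]; rewrite mulf_eq0 => /orP[/eqP->|/eqP E]; rewrite ?mul0r//.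
    by rewrite E f0 mulr0.
  by rewrite (_ : r = 1) ?f1 ?mulr0//; lra.
move: q0; rewrite le_eqVlt => /orP[/eqP q0|q0].
  rewrite -q0 f0 (corner x l) ?(corner z (1 - l))//; rewrite ?x0 ?z0//; try lra.
  - by left; move: q0; rewrite /q; nra.
  - by left; move: q0; rewrite /q; nra.
move: q1; rewrite le_eqVlt => /orP[/eqP q1|q1].
  rewrite q1 f1 (corner x l) ?(corner z (1 - l))//; rewrite ?x0 ?z0//; try lra.
  - by right; move: q1; rewrite /q; nra.
  - by right; move: q1; rewrite /q; nra.
have q01 : 0 < q < 1 by rewrite q0.
have [u1 [u0 tl]] := supporting_linesP af.2.
have [/andP[u10 _] /andP[u00 _]] := supporting_lines01 tl af.1 q01.
have below r : 0 <= r <= 1 -> f r <= r * u1 q + (1 - r) * u0 q.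
  move=> /andP[r0 r1]; move: r0; rewrite le_eqVlt => /orP[/eqP<-|r0].
    by rewrite f0; lra.
  move: r1; rewrite le_eqVlt => /orP[/eqP->|r1]; first by rewrite f1; lra.
  exact: (tl q r q01 (introT andP (conj r0 r1))).2.
have [-> _] := tl q q q01 q01.
have := ler_wpM2l t0 (below x (introT andP (conj x0 x1))).
have := ler_wpM2l (_ : 0 <= 1 - l) (below z (introT andP (conj z0 z1))).
rewrite subr_ge0 => /(_ t1).
set a := u1 q; set b := u0 q; clearbody a b => h1 h2.
have -> : q * a + (1 - q) * b =
    l * (x * a + (1 - x) * b) + (1 - l) * (z * a + (1 - z) * b) by rewrite /q; ring.
exact: lerD.
Qed.

End truncated_value.

Section stopped.
Context {R : realType} {d : measure_display} {Omega : measurableType d}.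
Implicit Types tau : Omega -> nat.

Lemma measurable_stopped (f : nat -> Omega -> R) tau :
  (forall k, measurable_fun setT (f k)) ->
  (forall k, measurable [set w | (tau w <= k)%N]) ->
  measurable_fun setT (fun w => f (tau w) w).
Proof.
move=> mf mtau _ B mB; rewrite setTI.
have mtauE k : measurable [set w | tau w = k].
  case: k => [|k].
    rewrite (_ : [set w | tau w = 0%N] = [set w | (tau w <= 0)%N])//.
    by apply/seteqP; split => w /=; [move=> ->|rewrite leqn0 => /eqP].
  rewrite (_ : [set w | _] = [set w | (tau w <= k.+1)%N] `\` [set w | (tau w <= k)%N]).
    exact: measurableD.
  apply/seteqP; split => w /=; first by move=> ->; rewrite leqnn ltnn.
  by move=> [h /negP]; rewrite -ltnNge => h'; apply/eqP; rewrite eqn_leq h.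
rewrite (_ : _ @^-1` B = \bigcup_k ([set w | tau w = k] `&` f k @^-1` B)).
  apply: bigcupT_measurable => k; apply: measurableI => //.
  by rewrite -[X in measurable X]setTI; exact: mf.
apply/seteqP; split => w /=; first by exists (tau w).
by move=> [k _ [/= -> ]].
Qed.

Lemma ge0_integral_split (mu : {measure set Omega -> \bar R}) (A : set Omega)
    (f : Omega -> \bar R) : measurable A -> measurable_fun setT f ->
  (forall w, 0 <= f w)%E ->
  (\int[mu]_w f w = \int[mu]_(w in A) f w + \int[mu]_(w in ~` A) f w)%E.
Proof.
move=> mA mf f0; rewrite -ge0_integral_setU ?setUv//.
- exact: measurableC.
- by apply/disj_setPCl.
Qed.

End stopped.

(** * Expected cost of a stopping rule up to a fixed horizon *)

Section optimal_stopping.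
Context {R : realType} {M : bayes_model R}.
Local Notation nu := (obs_measure M).
Local Notation mu := (prior M).
Local Notation theta0 := (threshold M).
Local Notation qq := (q nu mu theta0).
Local Notation yy := (yinv nu mu theta0).
Local Notation predictive := (predictive M).
Local Notation next_mean := (next_mean M).

Context {d : measure_display} {Omega : measurableType d}.
Variables (Theta : {mfun Omega >-> R}) (X : nat -> {mfun Omega >-> R}).
Variable P : nat -> R -> probability Omega R.
Hypothesis modelP : sampling_model nu mu theta0 Theta X P.
Variable c : R.
Hypothesis c_ge0 : 0 <= c.
Variables (n : nat) (p : R).
Hypothesis p01 : 0 < p < 1.

Local Notation Q := (P n p).
Local Notation y := (yy n p).
Local Notation F := (filtration X n).
Local Notation S := (obs_sum X n).
Local Notation cost := (stopping_cost nu mu theta0 X c n p).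

Definition stop_cost (k : nat) (w : Omega) : R :=
  Num.min (qq (n + k) (y + S k w)) (1 - qq (n + k) (y + S k w)) + c * k%:R.

Lemma stopping_costE tau w : cost tau w = stop_cost (tau w) w.
Proof. by []. Qed.

Lemma stop_cost_ge0 k w : 0 <= stop_cost k w.
Proof.
have /andP[h0 h1] := @q01 R M (n + k) (y + S k w).
apply: addr_ge0; last by apply: mulr_ge0 => //; exact: ler0n.
by rewrite le_min (ltW h0) subr_ge0 (ltW h1).
Qed.

Lemma measurable_state k : measurable_fun setT (fun w => y + S k w).
Proof. by apply: measurable_funD => //; exact: measurable_obs_sum. Qed.

Lemma measurable_stop_cost k : measurable_fun setT (stop_cost k).
Proof.
have mq := measurable_q (n + k) (measurable_state k).
apply: measurable_funD => //.
by apply: measurable_minr => //; exact: measurable_funB.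
Qed.

Section horizon.
Variable N : nat.

Definition value_at (k : nat) (s : R) : R :=
  vtrunc (M := M) c (N - k) (n + k) (qq (n + k) (y + s)).

Definition continue_value (k : nat) (s : R) : R :=
  c + next_mean (n + k) (vtrunc (M := M) c (N - k.+1) (n + k.+1)) (y + s).

Lemma value_atE k s : (k < N)%N ->
  value_at k s = Num.min (Num.min (qq (n + k) (y + s)) (1 - qq (n + k) (y + s)))
    (continue_value k s).
Proof.
move=> kN; rewrite /value_at /continue_value -(subnSK kN) vtruncS; last exact: q01.
by rewrite yinv_q addnS.
Qed.

Lemma value_at_last s :
  value_at N s = Num.min (qq (n + N) (y + s)) (1 - qq (n + N) (y + s)).
Proof. by rewrite /value_at subnn vtrunc0//; exact: q01. Qed.

Lemma value_at_le k s :
  value_at k s <= Num.min (qq (n + k) (y + s)) (1 - qq (n + k) (y + s)).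
Proof.
have := (@vtrunc_admissible R M c c_ge0 (N - k) (n + k)).1 _ (@q01 R M (n + k) (y + s)).
by move=> /andP[].
Qed.

Lemma value_at_ge0 k s : 0 <= value_at k s.
Proof.
have := (@vtrunc_admissible R M c c_ge0 (N - k) (n + k)).1 _ (@q01 R M (n + k) (y + s)).
by move=> /andP[].
Qed.

Lemma measurable_value_at k : measurable_fun setT (fun s => value_at k s).
Proof.
apply: measurable_admissible_q; first exact: vtrunc_admissible.
exact: measurable_funD.
Qed.

Lemma continue_value_ge0 k s : 0 <= continue_value k s.
Proof.
by apply: addr_ge0 => //; apply: next_mean_ge0; exact: vtrunc_admissible.
Qed.

Lemma measurable_next_mean m f : admissible f -> measurable_fun setT (next_mean m f).
Proof.
move=> af.
apply: (measurableT_comp (fine_measurable measurableT)).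
apply: (measurable_fun_fubini_tonelli_F
  (fun z : R * R => (f (qq m.+1 (z.1 + z.2)) * predictive m z.1 z.2)%:E)).
- have ms : measurable_fun setT (fun z : R * R => z.1 + z.2).
    by apply: measurable_funD; [exact: measurable_fst|exact: measurable_snd].
  apply/measurable_EFinP; apply: measurable_funM; first exact: measurable_admissible_q.
  apply: measurable_funM; first exact: measurable_tilted.
  exact: measurable_tilted_setTV measurable_fst.
- move=> z; rewrite lee_fin; apply: mulr_ge0; last by apply: ltW; exact: predictive_gt0.
  by have /andP[] := af.1 _ (@q01 R M m.+1 (z.1 + z.2)).
Qed.

Lemma measurable_continue_value k : measurable_fun setT (continue_value k).
Proof.
apply: measurable_funD => //.
apply: measurableT_comp; last exact: measurable_funD.
by apply: measurable_next_mean; exact: vtrunc_admissible.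
Qed.

Section rule.
Variable tau : Omega -> nat.
Hypothesis tauP : stopping_time X n tau.

(* [before_or_at j] is the conditional cost of stopping at [tau] before time
   [j] and continuing optimally, up to the horizon, from time [j] on. *)
Definition before_or_at (j k : nat) (w : Omega) : R :=
  if (k < j)%N then stop_cost k w else value_at j (S j w) + c * j%:R.

(** As [before_or_at], except that a path not stopped by time [j] takes one more observation even
    where stopping at [j] would be cheaper. *)
Definition continued (j k : nat) (w : Omega) : R :=
  if (k <= j)%N then stop_cost k w else continue_value j (S j w) + c * j%:R.

Let mtau k : measurable [set w | (tau w <= k)%N].
Proof. by apply: (@filtration_measurable _ _ _ X n k); exact: tauP. Qed.

Lemma before_or_at_ge0 j k w : 0 <= before_or_at j k w.
Proof.
rewrite /before_or_at; case: ifP => _; first exact: stop_cost_ge0.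
by apply: addr_ge0; [exact: value_at_ge0|apply: mulr_ge0 => //; exact: ler0n].
Qed.

Lemma continued_ge0 j k w : 0 <= continued j k w.
Proof.
rewrite /continued; case: ifP => _; first exact: stop_cost_ge0.
by apply: addr_ge0; [exact: continue_value_ge0|apply: mulr_ge0 => //; exact: ler0n].
Qed.

Lemma measurable_before_or_at j : measurable_fun setT (fun w => before_or_at j (tau w) w).
Proof.
apply: measurable_stopped => // k; rewrite /before_or_at.
case: (k < j)%N; first exact: measurable_stop_cost.
apply: measurable_funD => //.
by apply: measurableT_comp; [exact: measurable_value_at|exact: measurable_obs_sum].
Qed.

Lemma measurable_continued j : measurable_fun setT (fun w => continued j (tau w) w).
Proof.
apply: measurable_stopped => // k; rewrite /continued.
case: (k <= j)%N; first exact: measurable_stop_cost.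
apply: measurable_funD => //.
by apply: measurableT_comp; [exact: measurable_continue_value|exact: measurable_obs_sum].
Qed.

(** The integrands agree when [tau <= j]. The event [tau > j] is in [F j], so
    [next_mean_conditional] replaces the conditional mean there by the value at time [j + 1]; the
    [c] inside [continue_value] raises [c * j] to [c * (j + 1)]. *)
Lemma integral_continued j : (j < N)%N ->
  (\int[Q]_w (continued j (tau w) w)%:E = \int[Q]_w (before_or_at j.+1 (tau w) w)%:E)%E.
Proof.
move=> jN; pose A := [set w | (tau w <= j)%N].
have c0 k w : (0 <= (continued j k w)%:E)%E by rewrite lee_fin; exact: continued_ge0.
have b0 k w : (0 <= (before_or_at j.+1 k w)%:E)%E.
  by rewrite lee_fin; exact: before_or_at_ge0.
rewrite (ge0_integral_split Q (mtau j) ((measurable_EFinP _ _).2 (measurable_continued j))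
  (fun w => c0 _ w)).
rewrite (ge0_integral_split Q (mtau j) ((measurable_EFinP _ _).2 (measurable_before_or_at j.+1))
  (fun w => b0 _ w)).
congr (_ + _)%E.
  by apply: eq_integral => w /set_mem/= tj; rewrite /continued /before_or_at ltnS tj.
have FA : F j (~` A).
  have Fj : F j A := @tauP j.
  exact: (@measurableC _ (g_sigma_algebraType _) _ Fj).
have mA : measurable (~` A) by exact: measurableC (mtau j).
have av : admissible (vtrunc (M := M) c (N - j.+1) (n + j.+1)).
  exact: vtrunc_admissible.
have H := next_mean_conditional modelP p01 FA av.
pose g (w : Omega) : R := c * j.+1%:R.
have mnm : measurable_fun (~` A) (fun w =>
    (next_mean (n + j) (vtrunc (M := M) c (N - j.+1) (n + j.+1)) (y + S j w))%:E).
  apply: measurable_funTS; apply/measurable_EFinP.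
  by apply: measurableT_comp; [exact: measurable_next_mean|exact: measurable_state].
have mv : measurable_fun (~` A) (fun w => (value_at j.+1 (S j.+1 w))%:E).
  apply: measurable_funTS; apply/measurable_EFinP.
  by apply: measurableT_comp; [exact: measurable_value_at|exact: measurable_obs_sum].
have g0 w : (0 <= (g w)%:E)%E.
  by rewrite lee_fin; apply: mulr_ge0 => //; exact: ler0n.
transitivity (\int[Q]_(w in ~` A) ((next_mean (n + j)
    (vtrunc (M := M) c (N - j.+1) (n + j.+1)) (y + S j w))%:E + (g w)%:E))%E.
  apply: eq_integral => w /set_mem/= /negP tj.
  rewrite /continued (negbTE tj) /continue_value -EFinD /g; congr EFin.
  by rewrite -natr1; ring.
have mg : measurable_fun (~` A) (fun w => (g w)%:E).
  by apply/measurable_EFinP; exact: measurable_cst.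
rewrite ge0_integralD//; last by move=> w _; rewrite lee_fin; exact: next_mean_ge0.
transitivity (\int[Q]_(w in ~` A) (value_at j.+1 (S j.+1 w))%:E +
    \int[Q]_(w in ~` A) (g w)%:E)%E; first by congr (_ + _)%E; rewrite -[LHS]H.
rewrite -ge0_integralD//.
- apply: eq_integral => w /set_mem/= /negP tj.
  by rewrite /before_or_at ltnS (negbTE tj) -EFinD /value_at.
- by move=> w _; rewrite lee_fin; exact: value_at_ge0.
Qed.

Lemma integral_before_or_at0 : (\int[Q]_w (before_or_at 0 (tau w) w)%:E = (vtrunc (M := M) c N n p)%:E)%E.
Proof.
have E w : before_or_at 0 (tau w) w = vtrunc (M := M) c N n p.
  rewrite /before_or_at ltn0 mulr0 addr0 /value_at /obs_sum big_ord0 addr0 subn0 addn0.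
  by rewrite q_yinv.
under eq_integral do rewrite E.
rewrite integral_cst// [X in (_ * X)%E](_ : _ = 1%E) ?mule1//.
exact: probability_setT.
Qed.

(** The value is at most the cost of stopping and at most that of continuing, so [before_or_at j] is
    pointwise below [continued j]; the expected costs therefore increase with [j]. *)
Lemma value_le_before_or_at j : (j <= N)%N ->
  ((vtrunc (M := M) c N n p)%:E <= \int[Q]_w (before_or_at j (tau w) w)%:E)%E.
Proof.
elim: j => [|j IHj] jN; first by rewrite integral_before_or_at0.
apply: le_trans (IHj (ltnW jN)) _; rewrite -integral_continued//.
apply: ge0_le_integral => //.
- by move=> w _; rewrite lee_fin; exact: before_or_at_ge0.
- by apply/measurable_EFinP; exact: measurable_before_or_at.
- by apply/measurable_EFinP; exact: measurable_continued.
- move=> w _; rewrite lee_fin /before_or_at /continued.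
  case: (ltngtP (tau w) j) => tj; first by rewrite lexx.
    by rewrite lerD2r value_atE// ge_min lexx orbT.
  by rewrite tj /stop_cost lerD2r value_at_le.
Qed.

(* If [tau] stops exactly when stopping is optimal, no step loses anything. *)
Lemma before_or_at_le_value : (forall w, (tau w < N)%N ->
    Num.min (qq (n + tau w) (y + S (tau w) w)) (1 - qq (n + tau w) (y + S (tau w) w))
      <= value_at (tau w) (S (tau w) w)) ->
  (forall w k, (k < tau w)%N -> value_at k (S k w) <
    Num.min (qq (n + k) (y + S k w)) (1 - qq (n + k) (y + S k w))) ->
  forall j, (j <= N)%N ->
  (\int[Q]_w (before_or_at j (tau w) w)%:E <= (vtrunc (M := M) c N n p)%:E)%E.
Proof.
move=> opt1 opt2; elim=> [|j IHj] jN; first by rewrite integral_before_or_at0.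
apply: le_trans (IHj (ltnW jN)); rewrite -integral_continued//.
apply: ge0_le_integral => //.
- by move=> w _; rewrite lee_fin; exact: continued_ge0.
- by apply/measurable_EFinP; exact: measurable_continued.
- by apply/measurable_EFinP; exact: measurable_before_or_at.
- move=> w _; rewrite lee_fin /before_or_at /continued.
  case: (ltngtP (tau w) j) => tj; first by rewrite lexx.
    have := opt2 w j tj; rewrite value_atE// lerD2r.
    by rewrite gt_min ltxx/= => h; rewrite le_min (ltW h) lexx.
  rewrite -tj /stop_cost lerD2r; apply: opt1.
  by rewrite tj.
Qed.

End rule.
End horizon.
End optimal_stopping.

(** * The value function between its truncations and their error *)

Section value_function.
Context {R : realType} {M : bayes_model R}.
Local Notation nu := (obs_measure M).
Local Notation mu := (prior M).
Local Notation theta0 := (threshold M).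
Local Notation qq := (q nu mu theta0).
Local Notation yy := (yinv nu mu theta0).

Context {d : measure_display} {Omega : measurableType d}.
Variables (Theta : {mfun Omega >-> R}) (X : nat -> {mfun Omega >-> R}).
Variable P : nat -> R -> probability Omega R.
Hypothesis modelP : sampling_model nu mu theta0 Theta X P.
Variable c : R.
Hypothesis c_gt0 : 0 < c.
Let c_ge0 : 0 <= c := ltW c_gt0.

Section state.
Variables (n : nat) (p : R).
Hypothesis p01 : 0 < p < 1.

Local Notation Q := (P n p).
Local Notation y := (yy n p).
Local Notation F := (filtration X n).
Local Notation S := (obs_sum X n).
Local Notation cost := (stopping_cost nu mu theta0 X c n p).
Local Notation stop_cost := (stop_cost (M := M) X c n p).
Local Notation value_at := (value_at (M := M) c n p).

Let measurable_stopping_time tau : stopping_time X n tau ->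
  forall k, measurable [set w | (tau w <= k)%N].
Proof. by move=> tauP k; apply: (@filtration_measurable _ _ _ X n k); exact: tauP. Qed.

Lemma measurable_tail tau N : stopping_time X n tau -> measurable [set w | (N <= tau w)%N].
Proof.
move=> /measurable_stopping_time mtau; case: N => [|N].
  by have -> : [set w | (0 <= tau w)%N] = setT by apply/seteqP; split.
have -> : [set w | (N.+1 <= tau w)%N] = ~` [set w | (tau w <= N)%N].
  by apply/seteqP; split => w /=; rewrite ltnNge => /negP.
by apply: measurableC; exact: mtau.
Qed.

(** At [j = N] the truncated cost differs from the true one only where [tau >= N]. There it is at
    most [1 + c * N], hence at most 1 plus the true cost. *)
Lemma vtrunc_le_cost N tau : stopping_time X n tau ->
  ((vtrunc (M := M) c N n p)%:E <= 'E_Q[cost tau] + Q [set w | (N <= tau w)%N])%E.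
Proof.
move=> tauP; have mtau := measurable_stopping_time tauP.
have mA := measurable_tail N tauP; set A := [set w | (N <= tau w)%N] in mA *.
have H := value_le_before_or_at modelP c_ge0 p01 tauP (leqnn N).
apply: (le_trans H) => {H}.
have mcost : measurable_fun setT (fun w => (stop_cost (tau w) w)%:E).
  apply/measurable_EFinP; apply: measurable_stopped => // k.
  exact: measurable_stop_cost.
have mi : measurable_fun setT (fun w => (\1_A w : R)%:E).
  by apply/measurable_EFinP; exact: measurable_indic.
have -> : Q A = (\int[Q]_w (\1_A w)%:E)%E by rewrite integral_indic// setIT.
have -> : ('E_Q[cost tau])%E = (\int[Q]_w (stop_cost (tau w) w)%:E)%E by rewrite unlock.
have c0 w : (0 <= (stop_cost (tau w) w)%:E)%E by rewrite lee_fin; exact: stop_cost_ge0.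
rewrite -ge0_integralD//.
apply: ge0_le_integral => //.
- by move=> w _; rewrite lee_fin; exact: before_or_at_ge0.
- by apply/measurable_EFinP; exact: measurable_before_or_at.
- exact: emeasurable_funD.
- move=> w _; rewrite -EFinD lee_fin /before_or_at.
  case: ltnP => tN; first by rewrite lerDl.
  rewrite value_at_last indicE mem_set//= /stop_cost.
  have /andP[h0 h1] := @q01 R M (n + N) (y + S N w).
  have /andP[h2 h3] := @q01 R M (n + tau w) (y + S (tau w) w).
  have h4 : 0 <= Num.min (qq (n + tau w) (y + S (tau w) w)) (1 - qq (n + tau w) (y + S (tau w) w)).
    by rewrite le_min (ltW h2) subr_ge0 (ltW h3).
  have h5 : Num.min (qq (n + N) (y + S N w)) (1 - qq (n + N) (y + S N w)) <= 1.
    by rewrite ge_min (ltW h1).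
  have h6 : c * N%:R <= c * (tau w)%:R by rewrite ler_pM2l// ler_nat.
  have := lerD (lerD h4 h6) h5; rewrite add0r => h7.
  by rewrite [leLHS]addrC.
Qed.

Section optimal_rule.
Variable N : nat.

Definition stop_now (k : nat) (s : R) : bool :=
  Num.min (qq (n + k) (y + s)) (1 - qq (n + k) (y + s)) <= value_at N k s.

(** When no time before [N] qualifies, [find] returns the length [N] of the list, so the rule always
    stops by the horizon. *)
Definition optimal_rule (w : Omega) : nat := find (fun k => stop_now k (S k w)) (iota 0 N).

Lemma optimal_rule_le w : (optimal_rule w <= N)%N.
Proof. by rewrite -[leqRHS](size_iota 0); exact: find_size. Qed.

Lemma optimal_rule_stop w : (optimal_rule w < N)%N ->
  stop_now (optimal_rule w) (S (optimal_rule w) w).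
Proof.
move=> tN; have h : has (fun k => stop_now k (S k w)) (iota 0 N).
  by rewrite has_find size_iota.
by have := nth_find 0%N h; rewrite nth_iota.
Qed.

Lemma optimal_rule_before w k : (k < optimal_rule w)%N -> ~~ stop_now k (S k w).
Proof.
move=> kt; have := before_find 0%N kt; rewrite nth_iota ?add0n; first by move=> ->.
exact: leq_trans kt (optimal_rule_le w).
Qed.

Lemma filtration_stop_now k : F k [set w | stop_now k (S k w)].
Proof.
have ms : measurable_fun setT (fun s => y + s) by exact: measurable_funD.
have mq := measurable_q (n + k) ms.
have mb : measurable_fun setT (stop_now k).
  apply: measurable_fun_ler; last exact: measurable_value_at.
  by apply: measurable_minr => //; exact: measurable_funB.
have /= := mb measurableT [set true] I; rewrite setTI => mB.
exact: (@filtration_obs_sum _ _ _ X n k _ mB).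
Qed.

Lemma optimal_rule_stopping_time : stopping_time X n optimal_rule.
Proof.
move=> k; case: (leqP N k) => Nk.
  rewrite (_ : [set w | _] = setT); first exact: filtrationT.
  by apply/seteqP; split => // w _ /=; exact: leq_trans (optimal_rule_le w) Nk.
rewrite (_ : [set w | _] = \bigcup_(i in `I_k.+1) [set w | stop_now i (S i w)]).
  apply: (@bigcup_measurable _ (g_sigma_algebraType _)) => i /= ik.
  by apply: (filtration_sub (j := i)) => //; exact: filtration_stop_now.
apply/seteqP; split => w /=.
  move=> tk; exists (optimal_rule w) => //=; apply: optimal_rule_stop.
  exact: leq_ltn_trans tk Nk.
move=> [i /= ik si]; rewrite leqNgt; apply/negP => kt.
by have /negP := optimal_rule_before (leq_trans ik kt); exact.
Qed.

Lemma V_le_vtrunc : (V nu mu theta0 X P c n p <= (vtrunc (M := M) c N n p)%:E)%E.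
Proof.
have tP := optimal_rule_stopping_time.
rewrite /V p01; apply: le_trans (ereal_inf_lbound _) _.
  by exists optimal_rule.
rewrite unlock.
apply: le_trans (before_or_at_le_value modelP c_ge0 p01 tP _ _ (leqnn N)); last 2 first.
- by move=> w tN; exact: optimal_rule_stop.
- by move=> w k /optimal_rule_before; rewrite /stop_now -ltNge.
(* The rule never exceeds [N], and at [N] the value is the cost of stopping, so [before_or_at N] is
   the actual cost. *)
rewrite le_eqVlt; apply/orP; left; apply/eqP; apply: eq_integral => w _.
rewrite /before_or_at; case: ltnP => // Nt.
have tE : optimal_rule w = N by apply/eqP; rewrite eqn_leq Nt optimal_rule_le.
by rewrite value_at_last stopping_costE tE.
Qed.

End optimal_rule.
End state.
End value_function.

(** * Comparison of the problems started at different times *)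

Section monotonicity.
Context {R : realType} {M : bayes_model R}.
Local Notation nu := (obs_measure M).
Local Notation mu := (prior M).
Local Notation theta0 := (threshold M).
Local Notation qq := (q nu mu theta0).
Local Notation yy := (yinv nu mu theta0).
Local Notation next_mean := (next_mean M).

Context {d : measure_display} {Omega : measurableType d}.
Variables (Theta : {mfun Omega >-> R}) (X : nat -> {mfun Omega >-> R}).
Variable P : nat -> R -> probability Omega R.
Hypothesis modelP : sampling_model nu mu theta0 Theta X P.
Variable c : R.
Hypothesis c_gt0 : 0 < c.
Let c_ge0 : 0 <= c := ltW c_gt0.
Hypothesis convex_order : forall (p : R) (m n : nat), 0 < p < 1 -> (m <= n)%N ->
  convex_dominates (P m p) (Pi nu mu theta0 X m p 1) (P n p) (Pi nu mu theta0 X n p 1).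

Local Notation value := (vtrunc (M := M) c).
Local Notation V := (V nu mu theta0 X P c).

Lemma expectation_next n p f : 0 < p < 1 -> admissible f ->
  ('E_(P n p)[(fun s => (- f s)%R) \o Pi nu mu theta0 X n p 1] =
   - (next_mean n f (yy n p))%:E)%E.
Proof.
move=> p01 af; rewrite unlock.
have FT : filtration X n 0 setT by exact: filtrationT.
have H := next_mean_conditional modelP p01 FT af.
have f0 w : (0 <= (f (qq (n + 1) (yy n p + obs_sum X n 1 w)))%:E)%E.
  by rewrite lee_fin; have /andP[] := af.1 _ (@q01 R M (n + 1) (yy n p + obs_sum X n 1 w)).
have N0 := @integral_ge0N _ _ _ (P n p) setT _ (fun w _ => f0 w).
rewrite [LHS]N0.
congr (- _)%E; rewrite [LHS]H addn0.
under eq_integral do rewrite /obs_sum big_ord0 addr0.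
rewrite integral_cst// [X in (_ * X)%E](_ : _ = 1%E) ?mule1//.
exact: probability_setT.
Qed.

Lemma next_mean_nondecreasing m n p f : 0 < p < 1 -> (m <= n)%N ->
  admissible f -> f 0 = 0 -> f 1 = 0 ->
  next_mean m f (yy m p) <= next_mean n f (yy n p).
Proof.
move=> p01 mn af f0 f1.
have H := convex_order p01 mn (admissible_convexN af f0 f1).
have Em := expectation_next m p01 af; have En := expectation_next n p01 af.
move: Em En H; set a := ('E_(_)[_])%E; set b := ('E_(_)[_])%E => -> ->.
by rewrite leeN2 lee_fin.
Qed.

Lemma vtrunc_nondecreasing N m n p : (m <= n)%N -> value N m p <= value N n p.
Proof.
elim: N m n p => [|N IHN] m n p mn; first by [].
have [p01|p01] := boolP (0 < p < 1); last by rewrite !vtrunc_out.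
have H : next_mean m (value N m.+1) (yy m p) <= next_mean n (value N n.+1) (yy n p).
  (* The time of the state changes first, with the function fixed, by convex order; then the
     function changes, by induction. *)
  apply: (@le_trans _ _ (next_mean n (value N m.+1) (yy n p))).
    apply: next_mean_nondecreasing => //; first exact: vtrunc_admissible.
      by rewrite vtrunc_out// ltxx.
    by rewrite vtrunc_out// ltxx andbF.
  apply: next_mean_le; [exact: vtrunc_admissible|exact: vtrunc_admissible|].
  by move=> r _; exact: IHN.
rewrite [leLHS]vtruncS; last exact: p01.
rewrite [leRHS]vtruncS; last exact: p01.
exact: (le_min2 (lexx _) (lerD (lexx c) H)).
Qed.

Lemma stopping_time_tail n p (tau : Omega -> nat) : stopping_time X n tau ->
  (P n p [set w | (N <= tau w)%N] @[N --> \oo] --> 0)%E.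
Proof.
move=> tauP; have mA N := @measurable_tail R _ _ X n tau N tauP.
rewrite -(measure0 (P n p)).
have -> : set0 = \bigcap_N [set w : Omega | (N <= tau w)%N].
  apply/seteqP; split => // w /(_ (tau w).+1 I)/=.
  by rewrite ltnn.
apply: nonincreasing_cvg_mu => //.
- by apply: le_lt_trans (probability_le1 _ _) _ => //; exact: ltry.
- exact: bigcapT_measurable.
- by move=> i j ij; apply/subsetPset => w /=; exact: leq_trans.
Qed.

Lemma V_nondecreasing m n p : (m <= n)%N -> (V m p <= V n p)%E.
Proof.
move=> mn; have [p01|p01] := boolP (0 < p < 1); last first.
  by rewrite /Defs.V (negbTE p01).
rewrite [leRHS]/Defs.V p01; apply: le_ereal_inf_tmp => _ [tau tauP <-].
set E := ('E_(_)[_])%E.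
have H N : (V m p <= E + P n p [set w | (N <= tau w)%N])%E.
  apply: le_trans (V_le_vtrunc modelP c_gt0 m p01 N) _.
  apply: le_trans (vtrunc_le_cost modelP c_gt0 (n := n) p01 N tauP).
  by rewrite lee_fin; exact: vtrunc_nondecreasing.
(* The expected cost [E] may be infinite, but the tail probabilities are finite, so the sum
   converges to [E] in every case. *)
have cvgE : (E + P n p [set w | (N <= tau w)%N] @[N --> \oo] --> E)%E.
  rewrite -[X in _ --> X]adde0.
  apply: cvgeD; [exact: fin_num_adde_defl|exact: cvg_cst|exact: stopping_time_tail].
apply: (cvge_ge _ cvgE); exact: nearW.
Qed.

End monotonicity.

(** The continuation region at [n] is contained in the one at [m]. If [b1 n < b1 m], their midpoint
    would lie in the former and not in the latter; it is below [b2 n] because [b1 m <= 1/2 <= b2 n].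
    The argument for [b2] is symmetric. *)
Lemma boundaries_monotone (R : realType) (nu mu : {measure set R -> \bar R})
    (theta0 c : R) (d : measure_display) (Omega : measurableType d)
    (X : nat -> Omega -> R) (P : nat -> R -> probability Omega R) (b1 b2 : nat -> R) :
  (forall (pi : R) (m n : nat), 0 <= pi <= 1 -> (m <= n)%N ->
     (V nu mu theta0 X P c m pi <= V nu mu theta0 X P c n pi)%E) ->
  boundaries nu mu theta0 X P c b1 b2 ->
  (forall m n : nat, (m <= n)%N -> b1 m <= b1 n) /\
  (forall m n : nat, (m <= n)%N -> b2 n <= b2 m).
Proof.
move=> V_le [b1P b2P VP].
have sub m n pi : (m <= n)%N -> 0 <= pi <= 1 -> b1 n < pi < b2 n -> b1 m < pi < b2 m.
  move=> mn pi01 /(VP n pi pi01) h; apply/(VP m pi pi01).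
  exact: le_lt_trans (V_le pi m n pi01 mn) h.
split=> m n mn; rewrite leNgt; apply/negP => h.
- have /andP[a0 a1] := b1P m; have /andP[a2 a3] := b1P n; have /andP[a4 a5] := b2P n.
  have := sub m n ((b1 n + b1 m) / 2) mn.
  have -> : 0 <= (b1 n + b1 m) / 2 <= 1 by apply/andP; split; lra.
  have -> : b1 n < (b1 n + b1 m) / 2 < b2 n by apply/andP; split; lra.
  by move=> /(_ isT isT)/andP[]; lra.
- have /andP[a0 a1] := b2P m; have /andP[a2 a3] := b2P n; have /andP[a4 a5] := b1P n.
  have := sub m n ((b2 n + b2 m) / 2) mn.
  have -> : 0 <= (b2 n + b2 m) / 2 <= 1 by apply/andP; split; lra.
  have -> : b1 n < (b2 n + b2 m) / 2 < b2 n by apply/andP; split; lra.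
  by move=> /(_ isT isT)/andP[]; lra.
Qed.

Theorem theorem5p2 (R : realType)
    (nu : {sigma_finite_measure set R -> \bar R})
    (mu : probability R R) (theta0 c : R)
    (d : measure_display) (Omega : measurableType d)
    (Theta : {mfun Omega >-> R}) (X : nat -> {mfun Omega >-> R})
    (P : nat -> R -> probability Omega R)
    (nu_neq0 : nu setT <> 0%E)
    (mu_natural : mu (interior (natural_parameters nu)) = 1%E)
    (mu_Splus : (0 < mu (Splus mu theta0) < 1)%E)
    (mass_fin : forall n y, (mass nu mu n y (msupport mu) < +oo)%E)
    (c_gt0 : 0 < c)
    (modelP : sampling_model nu mu theta0 Theta X P)
    (convex_order : forall (pi : R) (m n : nat), 0 < pi < 1 -> (m <= n)%N ->
       convex_dominates (P m pi) (Pi nu mu theta0 X m pi 1)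
                        (P n pi) (Pi nu mu theta0 X n pi 1)) :
  (forall (pi : R) (m n : nat), 0 <= pi <= 1 -> (m <= n)%N ->
     (V nu mu theta0 X P c m pi <= V nu mu theta0 X P c n pi)%E) /\
  (forall b1 b2 : nat -> R, boundaries nu mu theta0 X P c b1 b2 ->
     (forall m n : nat, (m <= n)%N -> b1 m <= b1 n) /\
     (forall m n : nat, (m <= n)%N -> b2 n <= b2 m)).
Proof.
pose M := BayesModel nu_neq0 mu_natural mass_fin mu_Splus.
have V_le : forall (pi : R) (m n : nat), 0 <= pi <= 1 -> (m <= n)%N ->
    (V nu mu theta0 X P c m pi <= V nu mu theta0 X P c n pi)%E.
  move=> pi m n _; exact: (@V_nondecreasing R M d Omega Theta X P modelP c c_gt0 convex_order).
by split=> // b1 b2; exact: boundaries_monotone.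
Qed.
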